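(* Let $\Bbbk$ be a field. For any Hopf coquasigroup $H$ over $\Bbbk$, the category of right $H$-Hopf modules and the category of left $H$-Hopf modules are each equivalent to the category of $\Bbbk$-vector spaces.
   Context: All tensor products are over the field $\Bbbk$; the identity map on a vector space $V$ is denoted by $V$. Hopf coquasigroup: a vector space $H$ that is an associative unital algebra with product $\mu$ and unit $1$, and a counital (not necessarily coassociative) coalgebra with coproduct $\Delta$ and counit $\varepsilon$, such that $\Delta,\varepsilon$ are (unital) algebra homomorphisms and there is a linear map $S:H\to H$ (the antipode) with $(\mu\otimes H)\circ(S\otimes H\otimes H)\circ(H\otimes\Delta)\circ\Delta=1\otimes H=(\mu\otimes H)\circ(H\otimes S\otimes H)\circ(H\otimes\Delta)\circ\Delta$ and $(H\otimes\mu)\circ(H\otimes H\otimes S)\circ(\Delta\otimes H)\circ\Delta=H\otimes 1=(H\otimes\mu)\circ(H\otimes S\otimes H)\circ(\Delta\otimes H)\circ\Delta$. Right $H$-Hopf module: a vector space $M$ with a linear map (coaction) $\varrho^M:M\to M\otimes H$ that is counital, $(M\otimes\varepsilon)\circ\varrho^M=M$, but not necessarily coassociative, and an associative unital right $H$-action $\varrho_M:M\otimes H\to M$, such that $(M\otimes\mu)\circ(M\otimes H\otimes S)\circ(\varrho^M\otimes H)\circ\varrho^M=M\otimes 1=(M\otimes\mu)\circ(M\otimes S\otimes H)\circ(\varrho^M\otimes H)\circ\varrho^M$ and $\varrho^M\circ\varrho_M=(\varrho_M\otimes\mu)\circ(M\otimes\mathrm{flip}\otimes H)\circ(\varrho^M\otimes\Delta)$,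 where $\mathrm{flip}(g\otimes h)=h\otimes g$. Induced coaction: $\widehat{\varrho}^M=(\varrho_M\otimes H)\circ(\varrho_M\otimes H\otimes H)\circ(M\otimes S\otimes\Delta)\circ(\varrho^M\otimes H)\circ\varrho^M: M\to M\otimes H$. A linear map $f:M\to N$ of right $H$-Hopf modules is $H$-quasicolinear if $\widehat{\varrho}^N\circ f=(f\otimes H)\circ\widehat{\varrho}^M$. The category of right $H$-Hopf modules has as morphisms the linear maps that are both right $H$-linear and right $H$-quasicolinear. The category of left $H$-Hopf modules is defined symmetrically: objects are vector spaces $M$ with a counital (not necessarily coassociative) left coaction ${}^M\!\varrho:M\to H\otimes M$ and an associative unital left action ${}_M\varrho:H\otimes M\to M$ such that $(\mu\otimes M)\circ(S\otimes H\otimes M)\circ(H\otimes{}^M\!\varrho)\circ{}^M\!\varrho=1\otimes M=(\mu\otimes M)\circ(H\otimes S\otimes M)\circ(H\otimes{}^M\!\varrho)\circ{}^M\!\varrho$ and ${}^M\!\varrho\circ{}_M\varrho=(\mu\otimes{}_M\varrho)\circ(H\otimes\mathrm{flip}\otimes M)\circ(\Delta\otimes{}^M\!\varrho)$; morphisms are left $H$-linear maps commuting with the induced left coactions $(H\otimes{}_M\varrho)\circ(H\otimes H\otimes{}_M\varrho)\circ(\Delta\otimes S\otimes M)\circ(H\otimes{}^M\!\varrho)\circ{}^M\!\varrho:M\to H\otimes M$. *)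

(* Defs.v *)
From HB Require Import structures.
From mathcomp Require Import all_boot all_algebra.
From mathcomp Require Import boolp.

Set Implicit Arguments.
Unset Strict Implicit.
Unset Printing Implicit Defensive.

Import GRing.Theory.
Local Open Scope ring_scope.
Local Open Scope quotient_scope.

(* Formal sums [:: (u_1, v_1); ..; (u_n, v_n)], standing for the sum of the
   u_i (x) v_i, modulo the congruence generated by bilinearity. *)
Section TensorType.
Variables (K : fieldType) (U V : lmodType K).
Implicit Types s t r : seq (U * V).

Inductive tens_rel : seq (U * V) -> seq (U * V) -> Prop :=
| tens_rel_refl s : tens_rel s s
| tens_rel_sym s t : tens_rel s t -> tens_rel t s
| tens_rel_trans s t r : tens_rel s t -> tens_rel t r -> tens_rel s r
| tens_rel_cat s s' t t' :
    tens_rel s s' -> tens_rel t t' -> tens_rel (s ++ t) (s' ++ t')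
| tens_rel_catC s t : tens_rel (s ++ t) (t ++ s)
| tens_rel_0 v : tens_rel [:: (0, v)] [::]
| tens_rel_Dl u u' v : tens_rel [:: (u + u', v)] [:: (u, v); (u', v)]
| tens_rel_Dr u v v' : tens_rel [:: (u, v + v')] [:: (u, v); (u, v')]
| tens_rel_Z a u v : tens_rel [:: (a *: u, v)] [:: (u, a *: v)].

Definition tens_relb s t : bool := `[< tens_rel s t >].

Lemma tens_relb_refl : reflexive tens_relb.
Proof. by move=> s; apply/asboolP; exact: tens_rel_refl. Qed.

Lemma tens_relb_sym : symmetric tens_relb.
Proof. by move=> s t; apply/asboolP/asboolP; exact: tens_rel_sym. Qed.

Lemma tens_relb_trans : transitive tens_relb.
Proof.
by move=> s t r /asboolP h1 /asboolP h2; apply/asboolP; exact: tens_rel_trans h2.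
Qed.

Canonical tens_relb_equiv :=
  EquivRel tens_relb tens_relb_refl tens_relb_sym tens_relb_trans.

Definition tensor : Type := {eq_quot tens_relb}.

HB.instance Definition _ := Choice.on tensor.
HB.instance Definition _ := Quotient.on tensor.
HB.instance Definition _ : EqQuotient _ tens_relb tensor :=
  EqQuotient.on tensor.

Lemma pi_tensP s t :
  reflect (\pi_tensor s = \pi_tensor t) `[< tens_rel s t >].
Proof. exact: (eqmodP tens_relb_equiv). Qed.

Lemma pi_tens_eq s t : tens_rel s t -> \pi_tensor s = \pi_tensor t.
Proof. by move=> h; apply/pi_tensP/asboolP. Qed.

Lemma repr_pi_rel s : tens_rel (repr (\pi_tensor s)) s.
Proof. by apply/asboolP/pi_tensP; rewrite reprK. Qed.

Lemma tens_quot_ind (P : tensor -> Prop) :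
  (forall s, P (\pi_tensor s)) -> forall x, P x.
Proof. by move=> h x; rewrite -[x]reprK. Qed.

Definition tens_scale_seq (a : K) s := [seq (a *: p.1, p.2) | p <- s].

Lemma tens_scale_rel a s t :
  tens_rel s t -> tens_rel (tens_scale_seq a s) (tens_scale_seq a t).
Proof.
elim=> [{}s|{}s {}t _|{}s {}t r _ h1 _ h2|{}s s' {}t t' _ h1 _ h2|{}s {}t|v
       |u u' v|u v v'|b u v] /=.
- exact: tens_rel_refl.
- exact: tens_rel_sym.
- exact: tens_rel_trans h1 h2.
- by rewrite /tens_scale_seq !map_cat; exact: tens_rel_cat.
- by rewrite /tens_scale_seq !map_cat; exact: tens_rel_catC.
- by rewrite scaler0; exact: tens_rel_0.
- by rewrite scalerDr; exact: tens_rel_Dl.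
- exact: tens_rel_Dr.
- by rewrite scalerA mulrC -scalerA; exact: tens_rel_Z.
Qed.

Lemma tens_scale0_rel s : tens_rel (tens_scale_seq 0 s) [::].
Proof.
elim: s => [|p s IH] /=; first exact: tens_rel_refl.
rewrite scale0r -cat1s -[[::]]cats0.
exact: tens_rel_cat (tens_rel_0 _) IH.
Qed.

Lemma tens_scaleDl_rel a b s :
  tens_rel (tens_scale_seq (a + b) s)
           (tens_scale_seq a s ++ tens_scale_seq b s).
Proof.
elim: s => [|p s IH] /=; first exact: tens_rel_refl.
rewrite scalerDl -[X in tens_rel X _]cat1s.
apply: tens_rel_trans (tens_rel_cat (tens_rel_Dl _ _ _) IH) _.
rewrite -cat1s -[X in tens_rel _ X]cat1s -!catA.
apply: tens_rel_cat (tens_rel_refl _) _; rewrite !catA.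
rewrite -[X in tens_rel _ (_ ++ X)]cat1s catA.
apply: tens_rel_cat (tens_rel_refl _).
exact: tens_rel_catC.
Qed.

Definition tens_zero : tensor := \pi_tensor [::].
Definition tens_add (x y : tensor) : tensor := \pi_tensor (repr x ++ repr y).
Definition tens_scale (a : K) (x : tensor) : tensor :=
  \pi_tensor (tens_scale_seq a (repr x)).
Definition tens_opp (x : tensor) : tensor := tens_scale (-1) x.

Lemma pi_tens_add s t :
  tens_add (\pi_tensor s) (\pi_tensor t) = \pi_tensor (s ++ t).
Proof. by apply: pi_tens_eq; apply: tens_rel_cat; exact: repr_pi_rel. Qed.

Lemma pi_tens_scale a s :
  tens_scale a (\pi_tensor s) = \pi_tensor (tens_scale_seq a s).
Proof. by apply: pi_tens_eq; apply: tens_scale_rel; exact: repr_pi_rel. Qed.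

Lemma tens_addA : associative tens_add.
Proof.
move=> x y z; elim/tens_quot_ind: x => s; elim/tens_quot_ind: y => t.
elim/tens_quot_ind: z => r.
by rewrite !pi_tens_add catA.
Qed.

Lemma tens_addC : commutative tens_add.
Proof.
move=> x y; elim/tens_quot_ind: x => s; elim/tens_quot_ind: y => t.
rewrite !pi_tens_add.
exact/pi_tens_eq/tens_rel_catC.
Qed.

Lemma tens_add0 : left_id tens_zero tens_add.
Proof. by move=> x; elim/tens_quot_ind: x => s; rewrite pi_tens_add. Qed.

Lemma tens_scaleDl x : {morph tens_scale^~ x : a b / a + b >-> tens_add a b}.
Proof.
move=> a b; elim/tens_quot_ind: x => s; rewrite !pi_tens_scale pi_tens_add.
exact/pi_tens_eq/tens_scaleDl_rel.
Qed.

Lemma tens_scale1 : left_id 1 tens_scale.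
Proof.
move=> x; elim/tens_quot_ind: x => s; rewrite pi_tens_scale; congr (\pi_tensor _).
by elim: s => //= -[u v] s ->; rewrite scale1r.
Qed.

Lemma tens_addN : left_inverse tens_zero tens_opp tens_add.
Proof.
move=> x; rewrite -{2}[x]tens_scale1 /tens_opp -tens_scaleDl addNr.
elim/tens_quot_ind: x => s; rewrite pi_tens_scale.
exact/pi_tens_eq/tens_scale0_rel.
Qed.

HB.instance Definition _ :=
  GRing.isZmodule.Build tensor tens_addA tens_addC tens_add0 tens_addN.

Lemma tens_scaleA a b x : tens_scale a (tens_scale b x) = tens_scale (a * b) x.
Proof.
elim/tens_quot_ind: x => s; rewrite !pi_tens_scale; congr (\pi_tensor _).
by elim: s => //= -[u v] s ->; rewrite scalerA.
Qed.

Lemma tens_scaleDr : right_distributive tens_scale +%R.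
Proof.
move=> a x y; elim/tens_quot_ind: x => s; elim/tens_quot_ind: y => t.
rewrite /GRing.add /=.
by rewrite pi_tens_add !pi_tens_scale pi_tens_add /tens_scale_seq map_cat.
Qed.

HB.instance Definition _ := GRing.Zmodule_isLmodule.Build K tensor
  tens_scaleA tens_scale1 tens_scaleDr tens_scaleDl.

Lemma pi_tensD s t :
  \pi_tensor s + \pi_tensor t = \pi_tensor (s ++ t).
Proof. exact: pi_tens_add. Qed.

Lemma pi_tensZ a s :
  a *: \pi_tensor s = \pi_tensor (tens_scale_seq a s).
Proof. exact: pi_tens_scale. Qed.

Definition tens (u : U) (v : V) : tensor := \pi_tensor [:: (u, v)].

End TensorType.

Notation "U ⊗ V" := (tensor U%type V%type)
  (at level 40, left associativity) : type_scope.
Notation "u ⊗t v" := (tens u v) (at level 40, left associativity) : ring_scope.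

Section TensorUniversal.
Variables (K : fieldType) (U V : lmodType K).

Lemma tens_bilinear :
  bilinear_for *:%R *:%R (@tens K U V : U -> V -> U ⊗ V).
Proof.
have E a (s t r : seq (U * V)) : tens_rel r (tens_scale_seq a s ++ t) ->
    \pi_(U ⊗ V) r = a *: \pi_(U ⊗ V) s + \pi_(U ⊗ V) t.
  move=> h; rewrite /GRing.add /GRing.scale /= pi_tens_scale pi_tens_add.
  exact: pi_tens_eq.
split=> [v a u u'|u a v v']; apply: E; first exact: tens_rel_Dl.
apply: tens_rel_trans (tens_rel_Dr _ _ _) _.
rewrite -cat1s; apply: (@tens_rel_cat _ _ _ _ _ [:: _]); last exact: tens_rel_refl.
exact/tens_rel_sym/tens_rel_Z.
Qed.

Lemma tensDl u u' v : (u + u') ⊗t v = u ⊗t v + u' ⊗t v :> U ⊗ V.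
Proof. by have := tens_bilinear.1 v 1 u u'; rewrite /= !scale1r. Qed.

Lemma tensDr u v v' : u ⊗t (v + v') = u ⊗t v + u ⊗t v' :> U ⊗ V.
Proof. by have := tens_bilinear.2 u 1 v v'; rewrite /= !scale1r. Qed.

Lemma tens0l v : 0 ⊗t v = 0 :> U ⊗ V.
Proof. by apply: (addrI (0 ⊗t v)); rewrite -tensDl !addr0. Qed.

Lemma tens0r u : u ⊗t 0 = 0 :> U ⊗ V.
Proof. by apply: (addrI (u ⊗t 0)); rewrite -tensDr !addr0. Qed.

Lemma tensZl a u v : (a *: u) ⊗t v = a *: (u ⊗t v) :> U ⊗ V.
Proof. by have := tens_bilinear.1 v a u 0; rewrite /= tens0l !addr0. Qed.

Lemma tensZr a u v : u ⊗t (a *: v) = a *: (u ⊗t v) :> U ⊗ V.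
Proof. by have := tens_bilinear.2 u a v 0; rewrite /= tens0r !addr0. Qed.

Lemma pi_tens_sum (s : seq (U * V)) :
  \pi_(U ⊗ V) s = \sum_(p <- s) p.1 ⊗t p.2.
Proof.
elim: s => [|[u v] s IH]; first by rewrite big_nil.
by rewrite big_cons -IH -cat1s -pi_tensD.
Qed.

Lemma tens_ind (P : U ⊗ V -> Prop) :
    P 0 -> (forall u v x, P x -> P (u ⊗t v + x)) -> forall x, P x.
Proof.
move=> P0 PD; move=> x; elim/tens_quot_ind: x => s; rewrite pi_tens_sum.
by elim: s => [|p s IH]; rewrite ?big_nil ?big_cons //; exact: PD.
Qed.

Section Lift.
Variables (W : lmodType K) (f : U -> V -> W).

Definition tens_lift (bf : bilinear_for *:%R *:%R f) (x : U ⊗ V) : W :=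
  \sum_(p <- repr x) f p.1 p.2.

Hypothesis bf : bilinear_for *:%R *:%R f.

Lemma tens_lift_pi s : tens_lift bf (\pi_(U ⊗ V) s) = \sum_(p <- s) f p.1 p.2.
Proof.
have fDl u u' v : f (u + u') v = f u v + f u' v.
  by have := bf.1 v 1 u u'; rewrite /= !scale1r.
have fDr u v v' : f u (v + v') = f u v + f u v'.
  by have := bf.2 u 1 v v'; rewrite /= !scale1r.
have f0l v : f 0 v = 0 by apply: (addrI (f 0 v)); rewrite -fDl !addr0.
have f0r u : f u 0 = 0 by apply: (addrI (f u 0)); rewrite -fDr !addr0.
have fZl a u v : f (a *: u) v = a *: f u v.
  by have := bf.1 v a u 0; rewrite /= f0l !addr0.
have fZr a u v : f u (a *: v) = a *: f u v.
  by have := bf.2 u a v 0; rewrite /= f0r !addr0.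
rewrite /tens_lift.
move: (repr (\pi_(U ⊗ V) s)) (repr_pi_rel s) => r.
elim=> {r s}
  [s|s t _ ->|s t r _ -> _ ->|s s' t t' _ h1 _ h2|s t|v|u u' v|u v v'|a u v] //=.
- by rewrite !big_cat h1 h2.
- by rewrite !big_cat /= addrC.
- by rewrite big_seq1 big_nil.
- by rewrite !big_cons !big_nil /= fDl !addr0.
- by rewrite !big_cons !big_nil /= fDr !addr0.
- by rewrite !big_seq1 /= fZl fZr.
Qed.

Lemma tens_lift_linear : linear (tens_lift bf).
Proof.
move=> a x y; elim/tens_quot_ind: x => s; elim/tens_quot_ind: y => t.
rewrite pi_tensZ pi_tensD !tens_lift_pi.
rewrite big_cat big_map scaler_sumr; congr (_ + _); apply: eq_bigr => p _ /=.
have f0 : f 0 p.2 = 0.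
  by have := bf.1 p.2 (-1) 0 0; rewrite /= scaler0 addr0 scaleN1r addNr.
by have := bf.1 p.2 a p.1 0; rewrite /= f0 !addr0.
Qed.

HB.instance Definition _ :=
  GRing.isLinear.Build K (U ⊗ V) W *:%R (tens_lift bf) tens_lift_linear.

Lemma tens_liftE u v : tens_lift bf (u ⊗t v) = f u v.
Proof. by rewrite tens_lift_pi big_seq1. Qed.

End Lift.

Lemma tens_ext (W : lmodType K) (f g : {linear U ⊗ V -> W}) :
  (forall u v, f (u ⊗t v) = g (u ⊗t v)) -> f =1 g.
Proof.
move=> fg; elim/tens_ind=> [|u v x IH]; first by rewrite !linear0.
by rewrite !linearD IH fg.
Qed.

End TensorUniversal.

Definition idm (K : fieldType) (V : lmodType K) : {linear V -> V} := idfun.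

Section TensorMap.
Variables (K : fieldType) (U V U' V' : lmodType K).
Variables (f : {linear U -> U'}) (g : {linear V -> V'}).

Fact tens_map_bilinear :
  bilinear_for *:%R *:%R (fun u v => f u ⊗t g v : U' ⊗ V').
Proof.
by split=> [v a u u'|u a v v'] /=; rewrite linearP;
  [rewrite tensDl tensZl | rewrite tensDr tensZr].
Qed.

Definition tens_map : U ⊗ V -> U' ⊗ V' :=
  tens_lift tens_map_bilinear.

HB.instance Definition _ := GRing.Linear.on tens_map.

Lemma tens_mapE u v : tens_map (u ⊗t v) = f u ⊗t g v.
Proof. exact: tens_liftE. Qed.

End TensorMap.

Arguments tens_map : simpl never.

Notation "f ⊗m g" := (tens_map f g) (at level 40, left associativity)
  : ring_scope.

Section Canonical.
Variables (K : fieldType) (U V W X : lmodType K).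

Fact flip_bilinear : bilinear_for *:%R *:%R (fun u v => v ⊗t u : V ⊗ U).
Proof.
by split=> [v a u u'|u a v v'] /=;
  [rewrite tensDr tensZr | rewrite tensDl tensZl].
Qed.

Definition flip : U ⊗ V -> V ⊗ U :=
  tens_lift flip_bilinear.

HB.instance Definition _ := GRing.Linear.on flip.

Lemma flipE u v : flip (u ⊗t v) = v ⊗t u.
Proof. exact: tens_liftE. Qed.

Fact assocl_bilinear1 u :
  bilinear_for *:%R *:%R (fun v w => u ⊗t v ⊗t w : U ⊗ V ⊗ W).
Proof.
by split=> [w a v v'|v a w w'] /=; [rewrite tensDr tensZr tensDl tensZl
                                   |rewrite tensDr tensZr].
Qed.

Fact assocl_bilinear :
  bilinear_for *:%R *:%R (fun u x => tens_lift (assocl_bilinear1 u) x).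
Proof.
split=> [x a u u'|u a x x'] /=; last by rewrite linearP.
elim/tens_ind: x => [|v w x IH]; first by rewrite !linear0 addr0.
rewrite !linearD /= IH !tens_liftE ?tensDr ?tensZr ?tensDl ?tensZl.
by rewrite -!addrA; congr (_ + _); rewrite addrCA.
Qed.

Definition assocl : U ⊗ (V ⊗ W) -> (U ⊗ V) ⊗ W :=
  tens_lift assocl_bilinear.

HB.instance Definition _ := GRing.Linear.on assocl.

Lemma assoclE u v w : assocl (u ⊗t (v ⊗t w)) = u ⊗t v ⊗t w.
Proof. by rewrite /assocl /= !tens_liftE. Qed.

Fact assocr_bilinear1 w :
  bilinear_for *:%R *:%R (fun u v => u ⊗t (v ⊗t w) : U ⊗ (V ⊗ W)).
Proof.
by split=> [v a u u'|u a v v'] /=; [rewrite tensDl tensZl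
                                   |rewrite tensDl tensZl tensDr tensZr].
Qed.

Fact assocr_bilinear :
  bilinear_for *:%R *:%R (fun x w => tens_lift (assocr_bilinear1 w) x).
Proof.
split=> [w a x x'|x a w w'] /=; first by rewrite linearP.
elim/tens_ind: x => [|u v x IH]; first by rewrite !linear0 addr0.
rewrite !linearD /= IH !tens_liftE ?tensDr ?tensZr ?tensDl ?tensZl.
by rewrite -!addrA; congr (_ + _); rewrite addrCA.
Qed.

Definition assocr : (U ⊗ V) ⊗ W -> U ⊗ (V ⊗ W) :=
  tens_lift assocr_bilinear.

HB.instance Definition _ := GRing.Linear.on assocr.

Lemma assocrE u v w : assocr (u ⊗t v ⊗t w) = u ⊗t (v ⊗t w).
Proof. by rewrite /assocr /= !tens_liftE. Qed.

Fact unitr_bilinear :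
  bilinear_for *:%R *:%R (fun (u : U) (a : K^o) => (a : K) *: u).
Proof.
split=> [b a u u'|u a b b'] /=; first by rewrite scalerDr !scalerA mulrC.
by rewrite scalerDl scalerA.
Qed.

(* The identifications U (x) K = U = K (x) U. *)
Definition tens_unitr : U ⊗ K^o -> U :=
  tens_lift unitr_bilinear.

HB.instance Definition _ := GRing.Linear.on tens_unitr.

Lemma tens_unitrE u (a : K) : tens_unitr (u ⊗t (a : K^o)) = a *: u.
Proof. exact: tens_liftE. Qed.

Fact unitl_bilinear :
  bilinear_for *:%R *:%R (fun (a : K^o) (u : U) => (a : K) *: u).
Proof.
split=> [u a b b'|b a u u'] /=; last by rewrite scalerDr !scalerA mulrC.
by rewrite scalerDl scalerA.
Qed.

Definition tens_unitl : K^o ⊗ U -> U :=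
  tens_lift unitl_bilinear.

HB.instance Definition _ := GRing.Linear.on tens_unitl.

Lemma tens_unitlE (a : K) u : tens_unitl ((a : K^o) ⊗t u) = a *: u.
Proof. exact: tens_liftE. Qed.

End Canonical.

Arguments flip {K} U V : simpl never.
Arguments assocl {K} U V W : simpl never.
Arguments assocr {K} U V W : simpl never.
Arguments tens_unitr {K} U : simpl never.
Arguments tens_unitl {K} U : simpl never.

(* U (x) flip (x) X on a four-fold tensor product. *)
Definition mid_flip (K : fieldType) (U V W X : lmodType K) :
    (U ⊗ V) ⊗ (W ⊗ X) -> (U ⊗ W) ⊗ (V ⊗ X) :=
  assocl U W (V ⊗ X)
  \o (idm U ⊗m (assocr W V X \o (flip V W ⊗m idm X) \o assocl V W X))
  \o assocr U V (W ⊗ X).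

HB.instance Definition _ (K : fieldType) (U V W X : lmodType K) :=
  GRing.Linear.on (@mid_flip K U V W X).
Arguments mid_flip {K} U V W X : simpl never.

Lemma mid_flipE (K : fieldType) (U V W X : lmodType K)
    (u : U) (v : V) (w : W) (x : X) :
  mid_flip U V W X ((u ⊗t v) ⊗t (w ⊗t x)) = (u ⊗t w) ⊗t (v ⊗t x).
Proof.
rewrite /mid_flip /= assocrE tens_mapE /=.
by rewrite assoclE tens_mapE /= flipE assocrE assoclE.
Qed.

Section AlgebraMult.
Variables (K : fieldType) (A : algType K).

Fact alg_mul_bilinear : bilinear_for *:%R *:%R (fun a b : A => a * b).
Proof.
split=> [b k a a'|a k b b'] /=; first by rewrite mulrDl scalerAl.
by rewrite mulrDr scalerAr.
Qed.

Definition alg_mul : A ⊗ A -> A :=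
  tens_lift alg_mul_bilinear.

HB.instance Definition _ := GRing.Linear.on alg_mul.

Lemma alg_mulE a b : alg_mul (a ⊗t b) = a * b.
Proof. exact: tens_liftE. Qed.

End AlgebraMult.

Arguments alg_mul {K} A : simpl never.

(* An algType is a nontrivial ring; this excludes nothing, since the counit is
   unital and hence 1 <> 0 in any Hopf coquasigroup over a field. *)
Record hopfCoquasigroup (K : fieldType) := HopfCoquasigroup {
  hcq_alg :> algType K;
  hcq_delta : {linear hcq_alg -> hcq_alg ⊗ hcq_alg};
  hcq_eps : {linear hcq_alg -> K^o};
  hcq_antipode : {linear hcq_alg -> hcq_alg};
  hcq_counitr :
    tens_unitr hcq_alg \o (idm hcq_alg ⊗m hcq_eps) \o hcq_delta =1 idm hcq_alg;
  hcq_counitl :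
    tens_unitl hcq_alg \o (hcq_eps ⊗m idm hcq_alg) \o hcq_delta =1 idm hcq_alg;
  hcq_delta1 : hcq_delta 1 = 1 ⊗t 1;
  hcq_deltaM :
    hcq_delta \o alg_mul hcq_alg =1
      (alg_mul hcq_alg ⊗m alg_mul hcq_alg)
      \o mid_flip hcq_alg hcq_alg hcq_alg hcq_alg \o (hcq_delta ⊗m hcq_delta);
  hcq_eps1 : hcq_eps 1 = 1;
  hcq_epsM : forall g h : hcq_alg, hcq_eps (g * h) = hcq_eps g * hcq_eps h;
  hcq_antipodeSl :
    (alg_mul hcq_alg ⊗m idm hcq_alg) \o assocl hcq_alg hcq_alg hcq_alg
    \o (hcq_antipode ⊗m (idm hcq_alg ⊗m idm hcq_alg))
    \o (idm hcq_alg ⊗m hcq_delta) \o hcq_delta =1 (fun h => 1 ⊗t h);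
  hcq_antipodelS :
    (alg_mul hcq_alg ⊗m idm hcq_alg) \o assocl hcq_alg hcq_alg hcq_alg
    \o (idm hcq_alg ⊗m (hcq_antipode ⊗m idm hcq_alg))
    \o (idm hcq_alg ⊗m hcq_delta) \o hcq_delta =1 (fun h => 1 ⊗t h);
  hcq_antipoderS :
    (idm hcq_alg ⊗m alg_mul hcq_alg) \o assocr hcq_alg hcq_alg hcq_alg
    \o ((idm hcq_alg ⊗m idm hcq_alg) ⊗m hcq_antipode)
    \o (hcq_delta ⊗m idm hcq_alg) \o hcq_delta =1 (fun h => h ⊗t 1);
  hcq_antipodeSr :
    (idm hcq_alg ⊗m alg_mul hcq_alg) \o assocr hcq_alg hcq_alg hcq_alg
    \o ((idm hcq_alg ⊗m hcq_antipode) ⊗m idm hcq_alg)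
    \o (hcq_delta ⊗m idm hcq_alg) \o hcq_delta =1 (fun h => h ⊗t 1)
}.

Record rightHopfModule (K : fieldType) (H : hopfCoquasigroup K) :=
    RightHopfModule {
  rhm_space :> lmodType K;
  rhm_coact : {linear rhm_space -> rhm_space ⊗ H};
  rhm_act : {linear rhm_space ⊗ H -> rhm_space};
  rhm_counit :
    tens_unitr rhm_space \o (idm rhm_space ⊗m hcq_eps H) \o rhm_coact
      =1 idm rhm_space;
  rhm_act1 : forall m : rhm_space, rhm_act (m ⊗t 1) = m;
  rhm_actA : forall (m : rhm_space) (g h : H),
    rhm_act (rhm_act (m ⊗t g) ⊗t h) = rhm_act (m ⊗t (g * h));
  rhm_antipoderS :
    (idm rhm_space ⊗m alg_mul H) \o assocr rhm_space H H
    \o ((idm rhm_space ⊗m idm H) ⊗m hcq_antipode H)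
    \o (rhm_coact ⊗m idm H) \o rhm_coact =1 (fun m => m ⊗t 1);
  rhm_antipodeSr :
    (idm rhm_space ⊗m alg_mul H) \o assocr rhm_space H H
    \o ((idm rhm_space ⊗m hcq_antipode H) ⊗m idm H)
    \o (rhm_coact ⊗m idm H) \o rhm_coact =1 (fun m => m ⊗t 1);
  rhm_compat :
    rhm_coact \o rhm_act =1
      (rhm_act ⊗m alg_mul H) \o mid_flip rhm_space H H H
      \o (rhm_coact ⊗m hcq_delta H)
}.

Definition rhm_indcoact (K : fieldType) (H : hopfCoquasigroup K)
    (M : rightHopfModule H) : {linear M -> M ⊗ H} :=
  (rhm_act M ⊗m idm H) \o assocl M H H
  \o (rhm_act M ⊗m (idm H ⊗m idm H))
  \o ((idm M ⊗m hcq_antipode H) ⊗m hcq_delta H)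
  \o (rhm_coact M ⊗m idm H) \o rhm_coact M.

Record rhmHom (K : fieldType) (H : hopfCoquasigroup K)
    (M N : rightHopfModule H) := RhmHom {
  rhm_map :> {linear M -> N};
  rhm_hlinear : rhm_map \o rhm_act M =1 rhm_act N \o (rhm_map ⊗m idm H);
  rhm_qcolinear :
    rhm_indcoact N \o rhm_map =1 (rhm_map ⊗m idm H) \o rhm_indcoact M
}.

Record leftHopfModule (K : fieldType) (H : hopfCoquasigroup K) :=
    LeftHopfModule {
  lhm_space :> lmodType K;
  lhm_coact : {linear lhm_space -> H ⊗ lhm_space};
  lhm_act : {linear H ⊗ lhm_space -> lhm_space};
  lhm_counit :
    tens_unitl lhm_space \o (hcq_eps H ⊗m idm lhm_space) \o lhm_coact
      =1 idm lhm_space;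
  lhm_act1 : forall m : lhm_space, lhm_act (1 ⊗t m) = m;
  lhm_actA : forall (g h : H) (m : lhm_space),
    lhm_act (g ⊗t lhm_act (h ⊗t m)) = lhm_act ((g * h) ⊗t m);
  lhm_antipodeSl :
    (alg_mul H ⊗m idm lhm_space) \o assocl H H lhm_space
    \o (hcq_antipode H ⊗m (idm H ⊗m idm lhm_space))
    \o (idm H ⊗m lhm_coact) \o lhm_coact =1 (fun m => 1 ⊗t m);
  lhm_antipodelS :
    (alg_mul H ⊗m idm lhm_space) \o assocl H H lhm_space
    \o (idm H ⊗m (hcq_antipode H ⊗m idm lhm_space))
    \o (idm H ⊗m lhm_coact) \o lhm_coact =1 (fun m => 1 ⊗t m);
  lhm_compat :
    lhm_coact \o lhm_act =1
      (alg_mul H ⊗m lhm_act) \o mid_flip H H H lhm_space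
      \o (hcq_delta H ⊗m lhm_coact)
}.

Definition lhm_indcoact (K : fieldType) (H : hopfCoquasigroup K)
    (M : leftHopfModule H) : {linear M -> H ⊗ M} :=
  (idm H ⊗m lhm_act M) \o assocr H H M
  \o ((idm H ⊗m idm H) ⊗m lhm_act M)
  \o (hcq_delta H ⊗m (hcq_antipode H ⊗m idm M))
  \o (idm H ⊗m lhm_coact M) \o lhm_coact M.

Record lhmHom (K : fieldType) (H : hopfCoquasigroup K)
    (M N : leftHopfModule H) := LhmHom {
  lhm_map :> {linear M -> N};
  lhm_hlinear : lhm_map \o lhm_act M =1 lhm_act N \o (idm H ⊗m lhm_map);
  lhm_qcolinear :
    lhm_indcoact N \o lhm_map =1 (idm H ⊗m lhm_map) \o lhm_indcoact M
}.

Record category := Category {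
  obj :> Type;
  hom : obj -> obj -> Type;
  cid : forall A, hom A A;
  ccomp : forall A B C, hom B C -> hom A B -> hom A C;
  ccomp1l : forall A B (f : hom A B), ccomp (cid B) f = f;
  ccomp1r : forall A B (f : hom A B), ccomp f (cid A) = f;
  ccompA : forall A B C D (f : hom C D) (g : hom B C) (h : hom A B),
    ccomp f (ccomp g h) = ccomp (ccomp f g) h
}.
Arguments cid {c} A.

Record functor (C D : category) := Functor {
  fobj :> C -> D;
  fmap : forall A B : C, hom A B -> hom (fobj A) (fobj B);
  fmap1 : forall A : C, fmap (cid A) = cid (fobj A);
  fmapM : forall (A B E : C) (f : hom B E) (g : hom A B),
    fmap (ccomp f g) = ccomp (fmap f) (fmap g)
}.

Section FunctorOps.
Variables (C D E : category).

Definition functor_id : functor C C :=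
  @Functor C C (fun A => A) (fun A B f => f) (fun _ => erefl)
    (fun _ _ _ _ _ => erefl).

Variables (G : functor D E) (F : functor C D).

Fact functor_comp1 (A : C) : fmap G (fmap F (cid A)) = cid (G (F A)).
Proof. by rewrite !fmap1. Qed.

Fact functor_compM (A B X : C) (f : hom B X) (g : hom A B) :
  fmap G (fmap F (ccomp f g)) =
  ccomp (fmap G (fmap F f)) (fmap G (fmap F g)).
Proof. by rewrite !fmapM. Qed.

Definition functor_comp : functor C E :=
  @Functor C E (fun A => G (F A)) (fun A B f => fmap G (fmap F f))
    functor_comp1 functor_compM.

End FunctorOps.

Record natIso (C D : category) (F G : functor C D) := NatIso {
  nat_fwd : forall A : C, hom (F A) (G A);
  nat_bwd : forall A : C, hom (G A) (F A);
  nat_natural : forall (A B : C) (f : hom A B),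
    ccomp (nat_fwd B) (fmap F f) = ccomp (fmap G f) (nat_fwd A);
  nat_fwdK : forall A : C, ccomp (nat_bwd A) (nat_fwd A) = cid (F A);
  nat_bwdK : forall A : C, ccomp (nat_fwd A) (nat_bwd A) = cid (G A)
}.

Definition cat_equivalent (C D : category) : Prop :=
  exists (F : functor C D) (G : functor D C),
    inhabited (natIso (functor_comp G F) (functor_id C)) /\
    inhabited (natIso (functor_comp F G) (functor_id D)).

Lemma linear_map_ext (K : fieldType) (U V : lmodType K)
    (f g : {linear U -> V}) : f =1 g -> f = g.
Proof.
case: f g => [f [[fa] [fb]]] [g [[ga] [gb]]] /= /funext fg.
case: _ / fg ga gb => ga gb.
by rewrite (Prop_irrelevance fa ga) (Prop_irrelevance fb gb).
Qed.

Definition linear_comp (K : fieldType) (U V W : lmodType K)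
  (f : {linear V -> W}) (g : {linear U -> V}) : {linear U -> W} := f \o g.

Lemma tens_map_compl (K : fieldType) (U V W X : lmodType K)
    (f : {linear V -> W}) (g : {linear U -> V}) x :
  (linear_comp f g ⊗m idm X) x = (f ⊗m idm X) ((g ⊗m idm X) x).
Proof.
elim/tens_ind: x => [|u v x IH]; first by rewrite !linear0.
by rewrite !linearD /= IH !tens_mapE.
Qed.

Lemma tens_map_compr (K : fieldType) (U V W X : lmodType K)
    (f : {linear V -> W}) (g : {linear U -> V}) x :
  (idm X ⊗m linear_comp f g) x = (idm X ⊗m f) ((idm X ⊗m g) x).
Proof.
elim/tens_ind: x => [|u v x IH]; first by rewrite !linear0.
by rewrite !linearD /= IH !tens_mapE.
Qed.

Lemma tens_map_id (K : fieldType) (U V : lmodType K) x :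
  (idm U ⊗m idm V) x = x.
Proof.
elim/tens_ind: x => [|u v x IH]; first by rewrite linear0.
by rewrite linearD /= IH tens_mapE.
Qed.

Fact linear_comp1l (K : fieldType) (U V : lmodType K) (f : {linear U -> V}) :
  linear_comp (idm V) f = f.
Proof. exact: linear_map_ext. Qed.

Fact linear_comp1r (K : fieldType) (U V : lmodType K) (f : {linear U -> V}) :
  linear_comp f (idm U) = f.
Proof. exact: linear_map_ext. Qed.

Fact linear_compA (K : fieldType) (U V W X : lmodType K)
    (f : {linear W -> X}) (g : {linear V -> W}) (h : {linear U -> V}) :
  linear_comp f (linear_comp g h) = linear_comp (linear_comp f g) h.
Proof. exact: linear_map_ext. Qed.

Definition Vect (K : fieldType) : category :=
  @Category (lmodType K) (fun U V => {linear U -> V}) (@idm K)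
    (@linear_comp K) (@linear_comp1l K) (@linear_comp1r K) (@linear_compA K).

Section RightHopfModuleCategory.
Variables (K : fieldType) (H : hopfCoquasigroup K).
Implicit Types M N P Q : rightHopfModule H.

Lemma rhmHom_ext M N (f g : rhmHom M N) : f =1 g -> f = g.
Proof.
case: f g => [f f1 f2] [g g1 g2] /= /linear_map_ext fg.
case: _ / fg g1 g2 => g1 g2.
by rewrite (Prop_irrelevance f1 g1) (Prop_irrelevance f2 g2).
Qed.

Fact rhm_id_hlinear M :
  idm M \o rhm_act M =1 rhm_act M \o (idm M ⊗m idm H).
Proof. by move=> x /=; rewrite tens_map_id. Qed.

Fact rhm_id_qcolinear M :
  rhm_indcoact M \o idm M =1 (idm M ⊗m idm H) \o rhm_indcoact M.
Proof. by move=> x; rewrite [RHS]tens_map_id. Qed.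

Definition rhm_id M : rhmHom M M :=
  RhmHom (@rhm_id_hlinear M) (@rhm_id_qcolinear M).

Section Comp.
Variables (M N P : rightHopfModule H) (f : rhmHom N P) (g : rhmHom M N).

Fact rhm_comp_hlinear :
  linear_comp f g \o rhm_act M
    =1 rhm_act P \o (linear_comp f g ⊗m idm H).
Proof.
move=> x; rewrite [RHS]/comp tens_map_compl.
rewrite -[RHS](rhm_hlinear f ((g ⊗m idm H) x)).
by congr (f _); exact: (rhm_hlinear g x).
Qed.

Fact rhm_comp_qcolinear :
  rhm_indcoact P \o linear_comp f g
    =1 (linear_comp f g ⊗m idm H) \o rhm_indcoact M.
Proof.
move=> x; rewrite [RHS]/comp tens_map_compl.
have := rhm_qcolinear g x; rewrite [RHS]/comp => <-.
exact: (rhm_qcolinear f (g x)).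
Qed.

Definition rhm_comp : rhmHom M P :=
  RhmHom rhm_comp_hlinear rhm_comp_qcolinear.

End Comp.

Fact rhm_comp1l M N (f : rhmHom M N) : rhm_comp (rhm_id N) f = f.
Proof. exact: rhmHom_ext. Qed.

Fact rhm_comp1r M N (f : rhmHom M N) : rhm_comp f (rhm_id M) = f.
Proof. exact: rhmHom_ext. Qed.

Fact rhm_compA M N P Q
    (f : rhmHom P Q) (g : rhmHom N P) (h : rhmHom M N) :
  rhm_comp f (rhm_comp g h) = rhm_comp (rhm_comp f g) h.
Proof. exact: rhmHom_ext. Qed.

Definition RightHopfMod : category :=
  @Category (rightHopfModule H) (@rhmHom K H) rhm_id rhm_comp
    rhm_comp1l rhm_comp1r rhm_compA.

End RightHopfModuleCategory.

Section LeftHopfModuleCategory.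
Variables (K : fieldType) (H : hopfCoquasigroup K).
Implicit Types M N P Q : leftHopfModule H.

Lemma lhmHom_ext M N (f g : lhmHom M N) : f =1 g -> f = g.
Proof.
case: f g => [f f1 f2] [g g1 g2] /= /linear_map_ext fg.
case: _ / fg g1 g2 => g1 g2.
by rewrite (Prop_irrelevance f1 g1) (Prop_irrelevance f2 g2).
Qed.

Fact lhm_id_hlinear M :
  idm M \o lhm_act M =1 lhm_act M \o (idm H ⊗m idm M).
Proof. by move=> x /=; rewrite tens_map_id. Qed.

Fact lhm_id_qcolinear M :
  lhm_indcoact M \o idm M =1 (idm H ⊗m idm M) \o lhm_indcoact M.
Proof. by move=> x; rewrite [RHS]tens_map_id. Qed.

Definition lhm_id M : lhmHom M M :=
  LhmHom (@lhm_id_hlinear M) (@lhm_id_qcolinear M).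

Section Comp.
Variables (M N P : leftHopfModule H) (f : lhmHom N P) (g : lhmHom M N).

Fact lhm_comp_hlinear :
  linear_comp f g \o lhm_act M
    =1 lhm_act P \o (idm H ⊗m linear_comp f g).
Proof.
move=> x; rewrite [RHS]/comp tens_map_compr.
rewrite -[RHS](lhm_hlinear f ((idm H ⊗m g) x)).
by congr (f _); exact: (lhm_hlinear g x).
Qed.

Fact lhm_comp_qcolinear :
  lhm_indcoact P \o linear_comp f g
    =1 (idm H ⊗m linear_comp f g) \o lhm_indcoact M.
Proof.
move=> x; rewrite [RHS]/comp tens_map_compr.
have := lhm_qcolinear g x; rewrite [RHS]/comp => <-.
exact: (lhm_qcolinear f (g x)).
Qed.

Definition lhm_comp : lhmHom M P :=
  LhmHom lhm_comp_hlinear lhm_comp_qcolinear.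

End Comp.

Fact lhm_comp1l M N (f : lhmHom M N) : lhm_comp (lhm_id N) f = f.
Proof. exact: lhmHom_ext. Qed.

Fact lhm_comp1r M N (f : lhmHom M N) : lhm_comp f (lhm_id M) = f.
Proof. exact: lhmHom_ext. Qed.

Fact lhm_compA M N P Q
    (f : lhmHom P Q) (g : lhmHom N P) (h : lhmHom M N) :
  lhm_comp f (lhm_comp g h) = lhm_comp (lhm_comp f g) h.
Proof. exact: lhmHom_ext. Qed.

Definition LeftHopfMod : category :=
  @Category (leftHopfModule H) (@lhmHom K H) lhm_id lhm_comp
    lhm_comp1l lhm_comp1r lhm_compA.

End LeftHopfModuleCategory.

(* Main.v *)
(** For a right Hopf module [M], write [m_0 (x) m_1] for its coaction.  The map
    [E m = m_0 . S m_1] is an idempotent that satisfies [E (m . h) = eps h E m],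
    because [S] is antimultiplicative.  The map [m |-> E m_0 (x) m_1] splits the
    action and sends [E m] to [E m (x) 1], which identifies [M] with the free
    Hopf module on the fixed space of [E].  The induced coaction is
    [m |-> E m_0 . m_11 (x) m_12] and determines [E] through
    [E = act o (M (x) S) o indcoact]; hence an [H]-linear map is quasicolinear
    exactly when it commutes with [E].  On a free module [V (x) H], [E] is
    [v (x) h |-> eps h v (x) 1], so the morphisms between free modules are the
    maps [g (x) H], and [V |-> V (x) H] is fully faithful and essentially
    surjective. *)

From HB Require Import structures.
From mathcomp Require Import all_boot all_algebra.
Require Import Defs.

Set Implicit Arguments.
Unset Strict Implicit.
Unset Printing Implicit Defensive.

Import GRing.Theory.
Local Open Scope ring_scope.

(** * Rewriting and induction on pure tensors *)

Definition linE := (tens0l, tens0r, tensDl, tensDr, linear0, linearD, addr0,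
  mulr0, mul0r, scaler0, scale0r, mulrDl, mulrDr, scalerDl, scalerDr).

(* [x] has to occur linearly on both sides of the goal. *)
Ltac tens_elim x :=
  let u := fresh "u" in let v := fresh "v" in
  let y := fresh "y" in let IH := fresh "IH" in
  elim/tens_ind: x => [|u v y IH];
  [by rewrite /= ?linE //= ?linE
  |rewrite /= ?linE /= ?linE; congr (_ + _); last exact: IH;
   clear y IH; move: u v].

Lemma idmE (K : fieldType) (V : lmodType K) (v : V) : idm V v = v.
Proof. by []. Qed.

Definition tensE := (idmE, tens_mapE, assoclE, assocrE, flipE, mid_flipE,
  alg_mulE, tens_unitrE, tens_unitlE).

Ltac tens_simpl := rewrite /=; repeat (rewrite !tensE /=).

(** * Tensor products *)

Section Tensors.
Variable K : fieldType.

Lemma tens_sum (U V : lmodType K) (x : U ⊗ V) :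
  exists s : seq (U * V), x = \sum_(p <- s) p.1 ⊗t p.2.
Proof. by elim/tens_quot_ind: x => s; exists s; exact: pi_tens_sum. Qed.

Lemma comp_tens_sum (U V W X : lmodType K) (F : {linear U ⊗ V -> W})
    (D : {linear X -> U ⊗ V}) x s :
    D x = \sum_(p <- s) p.1 ⊗t p.2 ->
  (F \o D) x = \sum_(p <- s) F (p.1 ⊗t p.2).
Proof. by move=> /= ->; exact: linear_sum. Qed.

(** Transports an identity between Sweedler sums along a linear map; this is how the antipode axioms
    are applied below. *)
Lemma sum_linear_congr (U V : lmodType K) (F : {linear U -> V}) (I : Type)
    (s : seq I) (f : I -> U) x :
  \sum_(p <- s) f p = x -> \sum_(p <- s) F (f p) = F x.
Proof. by move=> <-; rewrite linear_sum. Qed.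

Section OneSided.
Variables U V : lmodType K.

(** Bundled below as a linear map in one factor, so that it can be composed with linear maps and
    serve as one side of [tens_ext]. *)
Definition tensl (v : V) (u : U) : U ⊗ V := u ⊗t v.
Fact tensl_linear v : linear (tensl v).
Proof. by move=> a u u'; rewrite /tensl tensDl tensZl. Qed.
HB.instance Definition _ v :=
  GRing.isLinear.Build K U (U ⊗ V) *:%R (tensl v) (tensl_linear v).

Definition tensr (u : U) (v : V) : U ⊗ V := u ⊗t v.
Fact tensr_linear u : linear (tensr u).
Proof. by move=> a v v'; rewrite /tensr tensDr tensZr. Qed.
HB.instance Definition _ u :=
  GRing.isLinear.Build K V (U ⊗ V) *:%R (tensr u) (tensr_linear u).

End OneSided.

End Tensors.

(** * The antipode *)

Section HopfCoquasigroup.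
Variables (K : fieldType) (H : hopfCoquasigroup K).
Implicit Types g h a b : H.

Local Notation Δ := (hcq_delta H).
Local Notation ε := (hcq_eps H).
Local Notation S := (hcq_antipode H).
Local Notation μ := (alg_mul H).

(** The multiplication performed by the antipode axioms once the outer coproduct is written as a
    sum: an element of [H] multiplies the adjacent leg of the inner coproduct. *)
Definition tlmul (M : lmodType K) a (x : H ⊗ M) : H ⊗ M :=
  (alg_mul H ⊗m idm M) (assocl H H M (a ⊗t x)).

Definition trmul (M : lmodType K) (x : M ⊗ H) a : M ⊗ H :=
  (idm M ⊗m alg_mul H) (assocr M H H (x ⊗t a)).

Lemma tlmulE (M : lmodType K) a b (m : M) : tlmul a (b ⊗t m) = (a * b) ⊗t m.
Proof. by rewrite /tlmul; tens_simpl. Qed.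

Lemma trmulE (M : lmodType K) a b (m : M) : trmul (m ⊗t a) b = m ⊗t (a * b).
Proof. by rewrite /trmul; tens_simpl. Qed.

(** One Sweedler sum for [Δ h] serves all four antipode axioms. The inner coproduct stays an
    unexpanded tensor, so that linear maps apply to it as a whole. *)
Lemma delta_sum h : exists2 s : seq (H * H), Δ h = \sum_(p <- s) p.1 ⊗t p.2 &
  [/\ \sum_(p <- s) tlmul (S p.1) (Δ p.2) = 1 ⊗t h,
      \sum_(p <- s) tlmul p.1 ((S ⊗m idm H) (Δ p.2)) = 1 ⊗t h,
      \sum_(p <- s) trmul (Δ p.1) (S p.2) = h ⊗t 1 &
      \sum_(p <- s) trmul ((idm H ⊗m S) (Δ p.1)) p.2 = h ⊗t 1].
Proof.
have [s Es] := tens_sum (Δ h); exists s => //.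
by split; [rewrite -hcq_antipodeSl|rewrite -hcq_antipodelS
  |rewrite -hcq_antipoderS|rewrite -hcq_antipodeSr]; rewrite (comp_tens_sum _ Es);
  apply: eq_bigr => p _; rewrite /= !tens_mapE /= ?tens_map_id.
Qed.

Lemma counitrE h : tens_unitr H ((idm H ⊗m ε) (Δ h)) = h.
Proof. exact: hcq_counitr. Qed.

Lemma counitlE h : tens_unitl H ((ε ⊗m idm H) (Δ h)) = h.
Proof. exact: hcq_counitl. Qed.

Lemma unitl_trmul (x : H ⊗ H) a :
  tens_unitl H ((ε ⊗m idm H) (trmul x a)) =
  tens_unitl H ((ε ⊗m idm H) x) * a.
Proof. by rewrite /trmul; tens_elim x => ? ?; tens_simpl; rewrite scalerAl. Qed.

Lemma unitr_tlmul (x : H ⊗ H) a :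
  tens_unitr H ((idm H ⊗m ε) (tlmul a x)) =
  a * tens_unitr H ((idm H ⊗m ε) x).
Proof. by rewrite /tlmul; tens_elim x => ? ?; tens_simpl; rewrite scalerAr. Qed.

(** Applying [ε] to the first leg of h_11 (x) h_12 S(h_2) = h (x) 1 leaves h_1 S(h_2) on the left,
    by the counit law. *)
Lemma mul_antipoder h : μ ((idm H ⊗m S) (Δ h)) = ε h *: 1.
Proof.
have [s Es [_ _ E _]] := delta_sum h.
have /= := sum_linear_congr (tens_unitl H \o (ε ⊗m idm H)) E.
rewrite !tensE => <-; apply: etrans (comp_tens_sum (μ \o (idm H ⊗m S)) Es) _.
by apply: eq_bigr => p _; rewrite unitl_trmul counitlE; tens_simpl.
Qed.

(** Apply [ε] to the second leg of S(h_1) h_21 (x) h_22 = 1 (x) h. *)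
Lemma mul_antipodel h : μ ((S ⊗m idm H) (Δ h)) = ε h *: 1.
Proof.
have [s Es [E _ _ _]] := delta_sum h.
have /= := sum_linear_congr (tens_unitr H \o (idm H ⊗m ε)) E.
rewrite !tensE => <-; apply: etrans (comp_tens_sum (μ \o (S ⊗m idm H)) Es) _.
by apply: eq_bigr => p _; rewrite unitr_tlmul counitrE; tens_simpl.
Qed.

Lemma delta_mul g h :
  Δ (g * h) = (μ ⊗m μ) (mid_flip H H H H (Δ g ⊗t Δ h)).
Proof. by have := hcq_deltaM (g ⊗t h); tens_simpl. Qed.

Lemma counitr_sum h (s : seq (H * H)) : Δ h = \sum_(p <- s) p.1 ⊗t p.2 ->
  \sum_(p <- s) (ε p.2 : K) *: p.1 = h.
Proof.
move=> Es; rewrite -[RHS]counitrE.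
apply/esym/(etrans (comp_tens_sum (tens_unitr H \o (idm H ⊗m ε)) Es)).
by apply: eq_bigr => p _; tens_simpl.
Qed.

(* Write [S (g h) = F ((1 (x) g) (x) (1 (x) h))] with
   [F ((a (x) b) (x) (c (x) d)) = a c S (b d)].  Substituting
   [1 (x) g = S(g_1) g_21 (x) g_22] and likewise for [h] leaves
   [S(h_1) S(g_1) (g_2 h_2)_1 S((g_2 h_2)_2)]. *)
Lemma antipodeM g h : S (g * h) = S h * S g.
Proof.
pose F : {linear _ -> H} :=
  μ \o (idm H ⊗m S) \o (μ ⊗m μ) \o mid_flip H H H H.
have Fl a x y : F (tlmul a x ⊗t y) = a * F (x ⊗t y).
  rewrite /F /tlmul; tens_elim x => ? ?; tens_elim y => ? ?; tens_simpl.
  by rewrite !mulrA.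
(* The other argument must have first leg 1, since [a] has to move to the left past it. So S(h_1) is
   extracted while that argument is still 1 (x) g, which puts S(h) to the left of S(g). *)
have Fr a b y : F ((1 ⊗t b) ⊗t tlmul a y) = a * F ((1 ⊗t b) ⊗t y).
  rewrite /F /tlmul; tens_elim y => ? ?; tens_simpl.
  by rewrite !mul1r !mulrA.
(* As [Δ] is multiplicative, the left side is (ab)_1 S((ab)_2). *)
have FΔ a b : F (Δ a ⊗t Δ b) = (ε a * ε b : K) *: 1.
  by rewrite -hcq_epsM -mul_antipoder delta_mul.
have [s Es [Ds _ _ _]] := delta_sum g; have [t Et [Dt _ _ _]] := delta_sum h.
have E d : F ((1 ⊗t g) ⊗t Δ d) = (ε d : K) *: S g.
  rewrite -[LHS](sum_linear_congr (F \o tensl (Δ d)) Ds).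
  rewrite -(sum_linear_congr S (counitr_sum Es)) scaler_sumr.
  apply: eq_bigr => p _; rewrite [LHS]Fl FΔ linearZ /= mulr_algr scalerA.
  by rewrite mulrC.
have -> : S (g * h) = F ((1 ⊗t g) ⊗t (1 ⊗t h)).
  by rewrite /F; tens_simpl; rewrite !mul1r.
rewrite -[LHS](sum_linear_congr (F \o tensr (1 ⊗t g)) Dt).
rewrite -(sum_linear_congr S (counitr_sum Et)) mulr_suml.
apply: eq_bigr => p _; rewrite [LHS]Fr E linearZ /=.
by rewrite -scalerAl -scalerAr.
Qed.

End HopfCoquasigroup.

(** * Right Hopf modules *)

Section RightModules.
Variables (K : fieldType) (H : hopfCoquasigroup K).
Implicit Types M N : rightHopfModule H.

Local Notation Δ := (hcq_delta H).
Local Notation ε := (hcq_eps H).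
Local Notation S := (hcq_antipode H).
Local Notation μ := (alg_mul H).
Local Notation ρ := (rhm_coact _).
Local Notation act := (rhm_act _).

Lemma rhm_coact_sum M (m : M) :
  exists2 s : seq (M * H), ρ m = \sum_(p <- s) p.1 ⊗t p.2 &
    \sum_(p <- s) trmul (ρ p.1) (S p.2) = m ⊗t 1 /\
    \sum_(p <- s) trmul ((idm M ⊗m S) (ρ p.1)) p.2 = m ⊗t 1.
Proof.
have [s Es] := tens_sum (rhm_coact M m); exists s => //.
by split; [rewrite -rhm_antipoderS|rewrite -rhm_antipodeSr];
  rewrite (comp_tens_sum _ Es); apply: eq_bigr => p _;
  rewrite /= !tens_mapE /= ?tens_map_id.
Qed.

Lemma rhm_act_trmul M (x : M ⊗ H) h : act (act x ⊗t h) = act (trmul x h).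
Proof. by rewrite /trmul; tens_elim x => ? ?; tens_simpl; rewrite rhm_actA. Qed.

Lemma rhm_coact_act M (m : M) h :
  ρ (act (m ⊗t h)) = (act ⊗m μ) (mid_flip M H H H (ρ m ⊗t Δ h)).
Proof. by have := rhm_compat (m ⊗t h); tens_simpl. Qed.

Definition rhm_proj M : M -> M := act \o (idm M ⊗m S) \o ρ.
HB.instance Definition _ M := GRing.Linear.on (@rhm_proj M).
Arguments rhm_proj : simpl never.
Local Notation E := (@rhm_proj _).

(** (m_0 h_1) S(m_1 h_2) = m_0 (h_1 S(h_2)) S(m_1), and the inner product is ε(h) 1. *)
Lemma rhm_proj_act M (m : M) h : E (act (m ⊗t h)) = (ε h : K) *: E m.
Proof.
rewrite /rhm_proj /= rhm_coact_act; move: (ρ m) => x; tens_elim x => u v.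
have P (y : H ⊗ H) :
    act ((idm M ⊗m S) ((act ⊗m μ) (mid_flip M H H H ((u ⊗t v) ⊗t y)))) =
    act (act (u ⊗t μ ((idm H ⊗m S) y)) ⊗t S v).
  by tens_elim y => ? ?; tens_simpl; rewrite antipodeM !rhm_actA mulrA.
rewrite P mul_antipoder tensZr linearZ /= tensZl linearZ /= rhm_act1.
by tens_simpl.
Qed.

Definition rhm_split M : M -> M ⊗ H := (E ⊗m idm H) \o ρ.
HB.instance Definition _ M := GRing.Linear.on (@rhm_split M).
Arguments rhm_split : simpl never.

(** E(m_0 h_1) (x) m_1 h_2 = E m_0 (x) m_1 ε(h_1) h_2, and the counit law turns ε(h_1) h_2 into
    h. *)
Lemma rhm_split_act M (m : M) h :
  rhm_split (act (m ⊗t h)) = trmul (rhm_split m) h.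
Proof.
rewrite /rhm_split /= rhm_coact_act /trmul; move: (ρ m) => x; tens_elim x => u v.
have P (y : H ⊗ H) :
    (E ⊗m idm H) ((act ⊗m μ) (mid_flip M H H H ((u ⊗t v) ⊗t y))) =
    E u ⊗t (v * tens_unitl H ((ε ⊗m idm H) y)).
  by tens_elim y => ? ?; tens_simpl; rewrite rhm_proj_act tensZl -scalerAr tensZr.
by rewrite P counitlE; tens_simpl.
Qed.

(** This is the action applied to the axiom m_00 (x) S(m_01) m_1 = m (x) 1. *)
Lemma rhm_splitK M (m : M) : act (rhm_split m) = m.
Proof.
have [s Es [_ E]] := rhm_coact_sum m.
rewrite -[RHS]rhm_act1 -(sum_linear_congr act E).
apply: (etrans (comp_tens_sum (act \o (@rhm_proj M ⊗m idm H)) Es)).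
by apply: eq_bigr => p _; rewrite -rhm_act_trmul; tens_simpl.
Qed.

(** By linearity over [H], the left side is E m_00 (x) m_01 S(m_1), to which the other antipode
    axiom applies. *)
Lemma rhm_split_proj M (m : M) : rhm_split (E m) = E m ⊗t 1.
Proof.
have [s Es [E _]] := rhm_coact_sum m.
rewrite -[RHS](tens_mapE (@rhm_proj M) (idm H)) -(sum_linear_congr (_ ⊗m _) E).
apply: (etrans (comp_tens_sum (@rhm_split M \o act \o (idm M ⊗m S)) Es)).
apply: eq_bigr => p _; tens_simpl; rewrite rhm_split_act /rhm_split /=.
by rewrite /trmul; move: (ρ p.1) => x; tens_elim x => ? ?; tens_simpl.
Qed.

Lemma rhm_split_counit M (m : M) :
  tens_unitr M ((idm M ⊗m ε) (rhm_split m)) = E m.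
Proof.
rewrite -{2}[m](rhm_counit m) /rhm_split /=; move: (ρ m) => x.
by tens_elim x => ? ?; tens_simpl; rewrite linearZ.
Qed.

Lemma rhm_projK M (m : M) : E (E m) = E m.
Proof.
rewrite -rhm_split_counit rhm_split_proj; tens_simpl.
by rewrite hcq_eps1 scale1r.
Qed.

(** The induced coaction is the coaction of a free module, transported to [M] along [rhm_split] and
    the action. *)
Lemma rhm_indcoactE M (m : M) :
  rhm_indcoact M m =
  (act ⊗m idm H) (assocl M H H ((idm M ⊗m Δ) (rhm_split m))).
Proof.
rewrite /rhm_split /rhm_indcoact /=; move: (ρ m) => x; tens_elim x => ? ?.
by tens_simpl; rewrite tens_map_id.
Qed.

(** For h = m_1 the left side is E m_0 . (h_1 S(h_2)), that is ε(m_1) E m_0. *)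
Lemma rhm_proj_indcoact M (m : M) :
  act ((idm M ⊗m S) (rhm_indcoact M m)) = E m.
Proof.
rewrite rhm_indcoactE -rhm_split_counit; move: (rhm_split m) => x.
tens_elim x => u v; tens_simpl.
have P (y : H ⊗ H) :
    act ((idm M ⊗m S) ((act ⊗m idm H) (assocl M H H (u ⊗t y)))) =
    act (u ⊗t μ ((idm H ⊗m S) y)).
  by tens_elim y => ? ?; tens_simpl; rewrite rhm_actA.
by rewrite P mul_antipoder tensZr linearZ /= rhm_act1.
Qed.

Lemma rhm_hom_act M N (f : rhmHom M N) m h :
  f (act (m ⊗t h)) = act (f m ⊗t h).
Proof. by have := rhm_hlinear f (m ⊗t h); tens_simpl. Qed.

Lemma rhm_hom_proj M N (f : rhmHom M N) (m : M) : f (E m) = E (f m).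
Proof.
rewrite -!rhm_proj_indcoact.
have -> : rhm_indcoact N (f m) = (f ⊗m idm H) (rhm_indcoact M m).
  exact: rhm_qcolinear.
move: (rhm_indcoact M m) => x; tens_elim x => ? ?; tens_simpl.
exact: rhm_hom_act.
Qed.

(** * Morphisms from linear maps that commute with the action and with [E] *)

Section HomOfProj.
Variables (M N : rightHopfModule H) (f : {linear M -> N}).
Hypothesis f_act : forall m h, f (act (m ⊗t h)) = act (f m ⊗t h).
Hypothesis f_proj : forall m, f (E m) = E (f m).

Fact rhm_hom_of_act : f \o act =1 act \o (f ⊗m idm H).
Proof. by move=> x; tens_elim x => ? ?; tens_simpl; rewrite f_act. Qed.

(** Since [f] is assumed to commute with [E] and not with the coaction [ρ], m is first replaced by E
    m_0 . m_1. Both [f] and [rhm_split] are linear over [H], and [rhm_split] is known on the image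
    of [E]. *)
Fact rhm_hom_of_split m : rhm_split (f m) = (f ⊗m idm H) (rhm_split m).
Proof.
rewrite -{1}[m]rhm_splitK /rhm_split /=; move: (ρ m) => x; tens_elim x => ? ?.
tens_simpl; rewrite f_act [LHS]rhm_split_act f_proj rhm_split_proj trmulE.
by rewrite mul1r.
Qed.

Fact rhm_hom_of_indcoact :
  rhm_indcoact N \o f =1 (f ⊗m idm H) \o rhm_indcoact M.
Proof.
move=> m; rewrite [LHS]rhm_indcoactE [RHS]/comp rhm_indcoactE rhm_hom_of_split.
move: (rhm_split m) => x; tens_elim x => u v; tens_simpl.
by move: (Δ v) => y; tens_elim y => ? ?; tens_simpl; rewrite f_act.
Qed.

Definition rhm_hom_of_proj : rhmHom M N :=
  RhmHom rhm_hom_of_act rhm_hom_of_indcoact.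

End HomOfProj.

Section HomInverse.
Variables (M N : rightHopfModule H) (f : rhmHom M N) (g : {linear N -> M}).
Hypotheses (fK : cancel f g) (gK : cancel g f).

Fact rhm_hom_inverse_act n h : g (act (n ⊗t h)) = act (g n ⊗t h).
Proof. by rewrite -{1}[n]gK -rhm_hom_act fK. Qed.

Fact rhm_hom_inverse_proj n : g (E n) = E (g n).
Proof. by rewrite -{1}[n]gK -rhm_hom_proj fK. Qed.

(** With this, the inverse of [rhm_coinv_hom] has to be constructed only as a linear map. *)
Definition rhm_hom_inverse : rhmHom N M :=
  rhm_hom_of_proj rhm_hom_inverse_act rhm_hom_inverse_proj.

End HomInverse.

End RightModules.

(** * Equivalences from fully faithful functors *)

Section EquivalenceCriterion.
Variables (C D : category) (G : functor D C).
Variables (preim : forall V W : D, hom (G V) (G W) -> hom V W).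
Hypothesis fmapK : forall (V W : D) (g : hom V W), preim (fmap G g) = g.
Hypothesis preimK : forall (V W : D) (f : hom (G V) (G W)), fmap G (preim f) = f.
Variables (F : C -> D).
Variables (i : forall M, hom M (G (F M))) (j : forall M, hom (G (F M)) M).
Hypothesis jK : forall M, ccomp (i M) (j M) = cid (G (F M)).
Hypothesis iK : forall M, ccomp (j M) (i M) = cid M.

Let G_inj V W (g g' : hom V W) : fmap G g = fmap G g' -> g = g'.
Proof. by move=> e; rewrite -[g]fmapK e fmapK. Qed.

(** The preimage under [G] of [f] conjugated by the chosen isomorphisms. *)
Let Fmap M N (f : hom M N) : hom (F M) (F N) :=
  preim (ccomp (i N) (ccomp f (j M))).

Fact quasi_inverse1 M : Fmap (cid M) = cid (F M).
Proof. by apply: G_inj; rewrite preimK ccomp1l jK fmap1. Qed.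

Fact quasi_inverseM M N P (f : hom N P) (g : hom M N) :
  Fmap (ccomp f g) = ccomp (Fmap f) (Fmap g).
Proof.
apply: G_inj; rewrite fmapM !preimK -!ccompA.
by rewrite [ccomp (j N) _]ccompA iK ccomp1l.
Qed.

Definition quasi_inverse : functor C D := Functor quasi_inverse1 quasi_inverseM.

(** Full faithfulness enters as the explicit inverse [preim], essential surjectivity as the chosen
    [F], [i] and [j]. The natural isomorphism on [C] is [j]; the one on [D] is the preimage of [j]
    at the objects [G V]. *)
Lemma equivalence_of_fully_faithful : cat_equivalent C D.
Proof.
exists quasi_inverse, G; split; constructor.
- apply: (@NatIso C C (functor_comp G quasi_inverse) (functor_id C) j i) => //.
  by move=> M N f; rewrite /= preimK !ccompA iK ccomp1l.
- apply: (@NatIso D D (functor_comp quasi_inverse G) (functor_id D)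
    (fun V => preim (j (G V))) (fun V => preim (i (G V)))) => [V W f|V|V] /=.
  + by apply: G_inj; rewrite !fmapM !preimK ccompA iK ccomp1l.
  + by apply: G_inj; rewrite fmapM !preimK jK fmap1.
  + by apply: G_inj; rewrite fmapM !preimK iK fmap1.
Qed.

End EquivalenceCriterion.

(** * Fixed spaces *)

Section FixedSpace.
Variables (K : fieldType) (V : lmodType K) (e : {linear V -> V}).

Definition fixed_pred : {pred V} := [pred v | e v == v].

Fact fixed_submod_closed : submod_closed fixed_pred.
Proof.
split=> [|a u v]; rewrite !inE ?linear0 // => /eqP eu /eqP ev.
by rewrite linearP eu ev.
Qed.
HB.instance Definition _ :=
  GRing.isSubmodClosed.Build K V fixed_pred fixed_submod_closed.

(** A subtype, so that the fixed space inherits a vector space structure and is an object of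
    [Vect]. *)
Record fixed := Fixed { fixed_val : V; _ : fixed_val \in fixed_pred }.
HB.instance Definition _ := [isSub for fixed_val].
HB.instance Definition _ := [Choice of fixed by <:].
HB.instance Definition _ := [SubChoice_isSubLmodule of fixed by <:].

Fact fixed_val_linear : linear fixed_val.
Proof. exact: (linearP (val : fixed -> V)). Qed.
HB.instance Definition _ :=
  GRing.isLinear.Build K fixed V *:%R fixed_val fixed_val_linear.

Lemma fixed_valP (x : fixed) : e (fixed_val x) = fixed_val x.
Proof. by case: x => v /= /eqP. Qed.

Hypothesis eK : forall v, e (e v) = e v.

Fact fixed_proj_subproof v : e v \in fixed_pred.
Proof. by rewrite inE eK. Qed.

Definition fixed_proj v : fixed := Fixed (fixed_proj_subproof v).

Fact fixed_proj_linear : linear fixed_proj.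
Proof.
move=> a u v; apply: val_inj; rewrite [RHS]fixed_val_linear.
exact: linearP.
Qed.
HB.instance Definition _ :=
  GRing.isLinear.Build K V fixed *:%R fixed_proj fixed_proj_linear.

Lemma fixed_valK x : fixed_proj (fixed_val x) = x.
Proof. by apply: val_inj; rewrite /= fixed_valP. Qed.

End FixedSpace.

(** * Free right Hopf modules *)

Section FreeRightModule.
Variables (K : fieldType) (H : hopfCoquasigroup K).

Local Notation Δ := (hcq_delta H).
Local Notation ε := (hcq_eps H).
Local Notation S := (hcq_antipode H).
Local Notation μ := (alg_mul H).
Local Notation E := (@rhm_proj _ _ _).

Section Objects.
Variable V : lmodType K.

Definition rfree_coact : V ⊗ H -> V ⊗ H ⊗ H := assocl V H H \o (idm V ⊗m Δ).
HB.instance Definition _ := GRing.Linear.on rfree_coact.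

Definition rfree_act : V ⊗ H ⊗ H -> V ⊗ H := (idm V ⊗m μ) \o assocr V H H.
HB.instance Definition _ := GRing.Linear.on rfree_act.

Lemma rfree_coactE v h : rfree_coact (v ⊗t h) = assocl V H H (v ⊗t Δ h).
Proof. by rewrite /rfree_coact; tens_simpl. Qed.

Lemma rfree_actE v g h : rfree_act (v ⊗t g ⊗t h) = v ⊗t (g * h).
Proof. by rewrite /rfree_act; tens_simpl. Qed.

Lemma trmul_assocl v (y : H ⊗ H) h :
  trmul (assocl V H H (v ⊗t y)) h = assocl V H H (v ⊗t trmul y h).
Proof. by rewrite /trmul; tens_elim y => ? ?; tens_simpl. Qed.

Lemma map_assocl (f : {linear H -> H}) v (y : H ⊗ H) :
  (idm (V ⊗ H) ⊗m f) (assocl V H H (v ⊗t y)) =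
  assocl V H H (v ⊗t (idm H ⊗m f) y).
Proof. by tens_elim y => ? ?; tens_simpl. Qed.

Lemma comp_rfree_coact_sum (W : lmodType K) (F : {linear V ⊗ H ⊗ H -> W})
    v h s :
    Δ h = \sum_(p <- s) p.1 ⊗t p.2 ->
  (F \o rfree_coact) (v ⊗t h) = \sum_(p <- s) F (v ⊗t p.1 ⊗t p.2).
Proof.
move=> Es; rewrite [LHS]/comp rfree_coactE.
apply: (etrans (comp_tens_sum (F \o assocl V H H \o tensr v) Es)).
by apply: eq_bigr => p _; rewrite /= /tensr assoclE.
Qed.

Fact rfree_counit :
  tens_unitr (V ⊗ H) \o (idm (V ⊗ H) ⊗m ε) \o rfree_coact =1 idm (V ⊗ H).
Proof.
move=> x; tens_elim x => v h; rewrite rfree_coactE -[in RHS](counitrE h) /=.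
move: (Δ h) => y.
by tens_elim y => ? ?; tens_simpl; rewrite tensZr.
Qed.

Fact rfree_act1 (x : V ⊗ H) : rfree_act (x ⊗t 1) = x.
Proof. by tens_elim x => ? ?; rewrite rfree_actE mulr1. Qed.

Fact rfree_actA (x : V ⊗ H) g h :
  rfree_act (rfree_act (x ⊗t g) ⊗t h) = rfree_act (x ⊗t (g * h)).
Proof. by tens_elim x => ? ?; rewrite !rfree_actE mulrA. Qed.

(** The axiom h_11 (x) h_12 S(h_2) = h (x) 1 of [H], tensored with [V]. *)
Fact rfree_antipoderS :
  (idm (V ⊗ H) ⊗m μ) \o assocr (V ⊗ H) H H
  \o ((idm (V ⊗ H) ⊗m idm H) ⊗m S)
  \o (rfree_coact ⊗m idm H) \o rfree_coact =1 (fun x => x ⊗t 1).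
Proof.
(* Both sides are linear, the right one in the bundled form [tensl 1], so pure tensors suffice. *)
apply: (@tens_ext _ _ _ _ (_ \o rfree_coact) (tensl 1)) => v h.
have [s Es [_ _ D _]] := delta_sum h.
rewrite -[RHS](assoclE v h 1).
rewrite -[RHS](sum_linear_congr (assocl V H H \o tensr v) D).
apply: (etrans (comp_rfree_coact_sum _ v Es)).
apply: eq_bigr => p _; rewrite /= !tens_mapE /= tens_map_id rfree_coactE.
exact: trmul_assocl.
Qed.

Fact rfree_antipodeSr :
  (idm (V ⊗ H) ⊗m μ) \o assocr (V ⊗ H) H H
  \o ((idm (V ⊗ H) ⊗m S) ⊗m idm H)
  \o (rfree_coact ⊗m idm H) \o rfree_coact =1 (fun x => x ⊗t 1).
Proof.
apply: (@tens_ext _ _ _ _ (_ \o rfree_coact) (tensl 1)) => v h.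
have [s Es [_ _ _ D]] := delta_sum h.
rewrite -[RHS](assoclE v h 1).
rewrite -[RHS](sum_linear_congr (assocl V H H \o tensr v) D).
apply: (etrans (comp_rfree_coact_sum _ v Es)).
apply: eq_bigr => p _; rewrite /= !tens_mapE /= rfree_coactE map_assocl.
exact: trmul_assocl.
Qed.

Fact rfree_compat :
  rfree_coact \o rfree_act =1
    (rfree_act ⊗m μ) \o mid_flip (V ⊗ H) H H H \o (rfree_coact ⊗m Δ).
Proof.
apply: tens_ext => x h; rewrite /=. tens_elim x => v g.
rewrite tens_mapE rfree_actE /= !rfree_coactE delta_mul.
move: (Δ g) (Δ h) => y z. tens_elim y => ? ?; tens_elim z => ? ?; tens_simpl.
by rewrite rfree_actE.
Qed.

Definition rfree : rightHopfModule H :=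
  RightHopfModule rfree_counit rfree_act1 rfree_actA
    rfree_antipoderS rfree_antipodeSr rfree_compat.

Definition rfree_eps : {linear rfree -> V} := tens_unitr V \o (idm V ⊗m ε).

Lemma rfree_epsE v h : rfree_eps (v ⊗t h) = (ε h : K) *: v.
Proof. by rewrite /rfree_eps; tens_simpl. Qed.

(** On v (x) h the projection gives v (x) h_1 S(h_2). *)
Lemma rfree_proj (x : rfree) : E x = rfree_eps x ⊗t 1.
Proof.
rewrite /rhm_proj /=; tens_elim x => v h; rewrite rfree_coactE.
have P (y : H ⊗ H) :
    rfree_act ((idm (V ⊗ H) ⊗m S) (assocl V H H (v ⊗t y))) =
    v ⊗t μ ((idm H ⊗m S) y).
  by tens_elim y => ? ?; tens_simpl; rewrite rfree_actE.
by rewrite P mul_antipoder tens_mapE tens_unitrE tensZl tensZr.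
Qed.

End Objects.

Section Morphisms.
Variables (V W : lmodType K).

Section Map.
Variable g : {linear V -> W}.

Fact rfree_map_act (x : rfree V) h :
  (g ⊗m idm H) (rhm_act _ (x ⊗t h)) =
  rhm_act (rfree W) ((g ⊗m idm H) x ⊗t h).
Proof.
by rewrite /=; tens_elim x => ? ?; rewrite rfree_actE !tens_mapE rfree_actE.
Qed.

Fact rfree_map_proj (x : rfree V) :
  (g ⊗m idm H) (E x) = E ((g ⊗m idm H) x : rfree W).
Proof.
rewrite !rfree_proj tens_mapE; congr (_ ⊗t _).
by tens_elim x => ? ?; tens_simpl; rewrite linearZ.
Qed.

Definition rfree_map : rhmHom (rfree V) (rfree W) :=
  @rhm_hom_of_proj K H (rfree V) (rfree W) (g ⊗m idm H) rfree_map_act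
    rfree_map_proj.

End Map.

(** Restricts [f] to the generators v (x) 1 and discards the factor [H] through [ε]. *)
Definition rfree_preim (f : rhmHom (rfree V) (rfree W)) : {linear V -> W} :=
  rfree_eps W \o f \o tensl 1.

Lemma rfree_mapK : cancel rfree_map rfree_preim.
Proof.
move=> g; apply: linear_map_ext => v.
by rewrite /rfree_preim /= /tensl; tens_simpl; rewrite hcq_eps1 scale1r.
Qed.

Lemma rfree_preimK : cancel rfree_preim rfree_map.
Proof.
move=> f; apply: rhmHom_ext => x /=; tens_elim x => v h.
have -> : v ⊗t h = rhm_act (rfree V) (v ⊗t 1 ⊗t h).
  by rewrite /= rfree_actE mul1r.
(* The vector v (x) 1 is fixed by [E], hence so is its image under [f], which therefore has the form
   w (x) 1. *)
have {2}-> : v ⊗t 1 = E (v ⊗t 1 : rfree V).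
  by rewrite rfree_proj rfree_epsE hcq_eps1 scale1r.
rewrite rhm_hom_act rhm_hom_proj rfree_proj /= !rfree_actE tens_mapE.
by rewrite !mul1r.
Qed.

End Morphisms.

Fact rfree_functor1 (V : lmodType K) : rfree_map (idm V) = rhm_id (rfree V).
Proof. by apply: rhmHom_ext => x /=; rewrite tens_map_id. Qed.

Fact rfree_functorM (U V W : lmodType K) (g : {linear V -> W})
    (f : {linear U -> V}) :
  rfree_map (linear_comp g f) = rhm_comp (rfree_map g) (rfree_map f).
Proof. by apply: rhmHom_ext => x /=; rewrite tens_map_compl. Qed.

Definition rfree_functor : functor (Vect K) (RightHopfMod H) :=
  @Functor (Vect K) (RightHopfMod H) rfree rfree_map
    rfree_functor1 rfree_functorM.

(** * Reconstruction of a right Hopf module from its coinvariants *)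

Section Coinvariants.
Variable M : rightHopfModule H.

Definition rhm_coinv := fixed (@rhm_proj K H M).

Definition rhm_coinv_gen : {linear rfree rhm_coinv -> M} :=
  rhm_act M \o (@fixed_val _ _ (@rhm_proj K H M) ⊗m idm H).

Lemma rhm_coinv_genE n h :
  rhm_coinv_gen (n ⊗t h) = rhm_act M (fixed_val n ⊗t h).
Proof. by rewrite /rhm_coinv_gen; tens_simpl. Qed.

Fact rhm_coinv_gen_act (x : rfree rhm_coinv) h :
  rhm_coinv_gen (rhm_act _ (x ⊗t h)) = rhm_act M (rhm_coinv_gen x ⊗t h).
Proof.
tens_elim x => n g.
by rewrite rfree_actE; tens_simpl; rewrite rhm_actA.
Qed.

(** Both sides send n (x) h to ε(h) n, since n is fixed by [E]. *)
Fact rhm_coinv_gen_proj (x : rfree rhm_coinv) :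
  rhm_coinv_gen (E x) = E (rhm_coinv_gen x).
Proof.
rewrite rfree_proj rhm_coinv_genE rhm_act1; tens_elim x => n h; tens_simpl.
by rewrite rhm_proj_act [in RHS]fixed_valP.
Qed.

Definition rhm_coinv_hom : rhmHom (rfree rhm_coinv) M :=
  rhm_hom_of_proj rhm_coinv_gen_act rhm_coinv_gen_proj.

(** This is [rhm_split] with its first leg corestricted to the fixed space. *)
Definition rhm_coinv_inv : {linear M -> rfree rhm_coinv} :=
  (fixed_proj (@rhm_projK K H M) ⊗m idm H) \o rhm_coact M.

Lemma rhm_coinv_invK : cancel rhm_coinv_inv rhm_coinv_hom.
Proof.
move=> m; rewrite -[RHS]rhm_splitK /rhm_split /=; congr (rhm_act _ _).
by move: (rhm_coact M m) => x; tens_elim x => ? ?; tens_simpl.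
Qed.

Lemma rhm_coinv_homK : cancel rhm_coinv_hom rhm_coinv_inv.
Proof.
pose p := fixed_proj (@rhm_projK K H M).
(* By idempotence [p] absorbs the projection, which turns the coaction into [rhm_split]. *)
have pE (x : M ⊗ H) :
    (p ⊗m idm H) x = (p ⊗m idm H) ((@rhm_proj K H M ⊗m idm H) x).
  tens_elim x => m h; tens_simpl; congr (_ ⊗t _).
  by apply: val_inj; rewrite /= rhm_projK.
move=> x; rewrite /= pE; tens_elim x => n h.
have e :
    (@rhm_proj K H M ⊗m idm H) (rhm_coact M (rhm_act M (fixed_val n ⊗t h))) =
    fixed_val n ⊗t h.
  rewrite [LHS]rhm_split_act -fixed_valP rhm_split_proj trmulE.
  by rewrite mul1r.
by rewrite tens_mapE e tens_mapE; congr (_ ⊗t _); exact: fixed_valK.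
Qed.

End Coinvariants.

Lemma right_hopf_modules_equivalent_vect :
  cat_equivalent (RightHopfMod H) (Vect K).
Proof.
apply: (@equivalence_of_fully_faithful _ _ rfree_functor rfree_preim rfree_mapK
  rfree_preimK rhm_coinv
  (fun M => rhm_hom_inverse (@rhm_coinv_homK M) (@rhm_coinv_invK M))
  rhm_coinv_hom).
- by move=> M; apply: rhmHom_ext => x; exact: rhm_coinv_homK.
- by move=> M; apply: rhmHom_ext => x; exact: rhm_coinv_invK.
Qed.

End FreeRightModule.

(** * Left Hopf modules *)

Section LeftModules.
Variables (K : fieldType) (H : hopfCoquasigroup K).
Implicit Types M N : leftHopfModule H.

Local Notation Δ := (hcq_delta H).
Local Notation ε := (hcq_eps H).
Local Notation S := (hcq_antipode H).
Local Notation μ := (alg_mul H).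
Local Notation ρ := (lhm_coact _).
Local Notation act := (lhm_act _).

Lemma lhm_coact_sum M (m : M) :
  exists2 s : seq (H * M), ρ m = \sum_(p <- s) p.1 ⊗t p.2 &
    \sum_(p <- s) tlmul (S p.1) (ρ p.2) = 1 ⊗t m /\
    \sum_(p <- s) tlmul p.1 ((S ⊗m idm M) (ρ p.2)) = 1 ⊗t m.
Proof.
have [s Es] := tens_sum (lhm_coact M m); exists s => //.
by split; [rewrite -lhm_antipodeSl|rewrite -lhm_antipodelS];
  rewrite (comp_tens_sum _ Es); apply: eq_bigr => p _;
  rewrite /= !tens_mapE /= ?tens_map_id.
Qed.

Lemma lhm_act_tlmul M h (x : H ⊗ M) : act (h ⊗t act x) = act (tlmul h x).
Proof. by rewrite /tlmul; tens_elim x => ? ?; tens_simpl; rewrite lhm_actA. Qed.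

Lemma lhm_coact_act M h (m : M) :
  ρ (act (h ⊗t m)) = (μ ⊗m act) (mid_flip H H H M (Δ h ⊗t ρ m)).
Proof. by have := lhm_compat (h ⊗t m); tens_simpl. Qed.

Definition lhm_proj M : M -> M := act \o (S ⊗m idm M) \o ρ.
HB.instance Definition _ M := GRing.Linear.on (@lhm_proj M).
Arguments lhm_proj : simpl never.
Local Notation E := (@lhm_proj _).

(** With m_1 (x) m_0 for the left coaction, S(h_1 m_1) (h_2 m_0) = S(m_1) (S(h_1) h_2) m_0. *)
Lemma lhm_proj_act M h (m : M) : E (act (h ⊗t m)) = (ε h : K) *: E m.
Proof.
rewrite /lhm_proj /= lhm_coact_act; move: (ρ m) => x; tens_elim x => v u.
have P (y : H ⊗ H) :
    act ((S ⊗m idm M) ((μ ⊗m act) (mid_flip H H H M (y ⊗t (v ⊗t u))))) =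
    act (S v ⊗t act (μ ((S ⊗m idm H) y) ⊗t u)).
  by tens_elim y => ? ?; tens_simpl; rewrite antipodeM !lhm_actA mulrA.
rewrite P mul_antipodel tensZl linearZ /= tensZr linearZ /= lhm_act1.
by tens_simpl.
Qed.

Definition lhm_split M : M -> H ⊗ M := (idm H ⊗m E) \o ρ.
HB.instance Definition _ M := GRing.Linear.on (@lhm_split M).
Arguments lhm_split : simpl never.

Lemma lhm_split_act M h (m : M) :
  lhm_split (act (h ⊗t m)) = tlmul h (lhm_split m).
Proof.
rewrite /lhm_split /= lhm_coact_act /tlmul; move: (ρ m) => x; tens_elim x => v u.
have P (y : H ⊗ H) :
    (idm H ⊗m E) ((μ ⊗m act) (mid_flip H H H M (y ⊗t (v ⊗t u)))) =
    (tens_unitr H ((idm H ⊗m ε) y) * v) ⊗t E u.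
  by tens_elim y => ? ?; tens_simpl; rewrite lhm_proj_act tensZr -scalerAl tensZl.
by rewrite P counitrE; tens_simpl.
Qed.

(** This is the action applied to the axiom m_1 S(m_01) (x) m_00 = 1 (x) m. *)
Lemma lhm_splitK M (m : M) : act (lhm_split m) = m.
Proof.
have [s Es [_ E]] := lhm_coact_sum m.
rewrite -[RHS]lhm_act1 -(sum_linear_congr act E).
apply: (etrans (comp_tens_sum (act \o (idm H ⊗m @lhm_proj M)) Es)).
by apply: eq_bigr => p _; rewrite -lhm_act_tlmul; tens_simpl.
Qed.

(** By linearity over [H], the left side is S(m_1) m_01 (x) E m_00. *)
Lemma lhm_split_proj M (m : M) : lhm_split (E m) = 1 ⊗t E m.
Proof.
have [s Es [E _]] := lhm_coact_sum m.
rewrite -[RHS](tens_mapE (idm H) (@lhm_proj M)) -(sum_linear_congr (_ ⊗m _) E).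
apply: (etrans (comp_tens_sum (@lhm_split M \o act \o (S ⊗m idm M)) Es)).
apply: eq_bigr => p _; tens_simpl; rewrite lhm_split_act /lhm_split /=.
by rewrite /tlmul; move: (ρ p.2) => x; tens_elim x => ? ?; tens_simpl.
Qed.

Lemma lhm_split_counit M (m : M) :
  tens_unitl M ((ε ⊗m idm M) (lhm_split m)) = E m.
Proof.
rewrite -{2}[m](lhm_counit m) /lhm_split /=; move: (ρ m) => x.
by tens_elim x => ? ?; tens_simpl; rewrite linearZ.
Qed.

Lemma lhm_projK M (m : M) : E (E m) = E m.
Proof.
rewrite -lhm_split_counit lhm_split_proj; tens_simpl.
by rewrite hcq_eps1 scale1r.
Qed.

Lemma lhm_indcoactE M (m : M) :
  lhm_indcoact M m =
  (idm H ⊗m act) (assocr H H M ((Δ ⊗m idm M) (lhm_split m))).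
Proof.
rewrite /lhm_split /lhm_indcoact /=; move: (ρ m) => x; tens_elim x => ? ?.
by tens_simpl; rewrite tens_map_id.
Qed.

(** For h = m_1 the left side is (S(h_1) h_2) . E m_0, that is ε(m_1) E m_0. *)
Lemma lhm_proj_indcoact M (m : M) :
  act ((S ⊗m idm M) (lhm_indcoact M m)) = E m.
Proof.
rewrite lhm_indcoactE -lhm_split_counit; move: (lhm_split m) => x.
tens_elim x => v u; tens_simpl.
have P (y : H ⊗ H) :
    act ((S ⊗m idm M) ((idm H ⊗m act) (assocr H H M (y ⊗t u)))) =
    act (μ ((S ⊗m idm H) y) ⊗t u).
  by tens_elim y => ? ?; tens_simpl; rewrite lhm_actA.
by rewrite P mul_antipodel tensZl linearZ /= lhm_act1.
Qed.

Lemma lhm_hom_act M N (f : lhmHom M N) h m :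
  f (act (h ⊗t m)) = act (h ⊗t f m).
Proof. by have := lhm_hlinear f (h ⊗t m); tens_simpl. Qed.

Lemma lhm_hom_proj M N (f : lhmHom M N) (m : M) : f (E m) = E (f m).
Proof.
rewrite -!lhm_proj_indcoact.
have -> : lhm_indcoact N (f m) = (idm H ⊗m f) (lhm_indcoact M m).
  exact: lhm_qcolinear.
move: (lhm_indcoact M m) => x; tens_elim x => ? ?; tens_simpl.
exact: lhm_hom_act.
Qed.

Section HomOfProj.
Variables (M N : leftHopfModule H) (f : {linear M -> N}).
Hypothesis f_act : forall h m, f (act (h ⊗t m)) = act (h ⊗t f m).
Hypothesis f_proj : forall m, f (E m) = E (f m).

Fact lhm_hom_of_act : f \o act =1 act \o (idm H ⊗m f).
Proof. by move=> x; tens_elim x => ? ?; tens_simpl; rewrite f_act. Qed.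

(** Writing m as m_1 . E m_0 reduces the claim to the image of [E], with which [f] commutes. *)
Fact lhm_hom_of_split m : lhm_split (f m) = (idm H ⊗m f) (lhm_split m).
Proof.
rewrite -{1}[m]lhm_splitK /lhm_split /=; move: (ρ m) => x; tens_elim x => ? ?.
tens_simpl; rewrite f_act [LHS]lhm_split_act f_proj lhm_split_proj tlmulE.
by rewrite mulr1.
Qed.

Fact lhm_hom_of_indcoact :
  lhm_indcoact N \o f =1 (idm H ⊗m f) \o lhm_indcoact M.
Proof.
move=> m; rewrite [LHS]lhm_indcoactE [RHS]/comp lhm_indcoactE lhm_hom_of_split.
move: (lhm_split m) => x; tens_elim x => v u; tens_simpl.
by move: (Δ v) => y; tens_elim y => ? ?; tens_simpl; rewrite f_act.
Qed.

Definition lhm_hom_of_proj : lhmHom M N :=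
  LhmHom lhm_hom_of_act lhm_hom_of_indcoact.

End HomOfProj.

Section HomInverse.
Variables (M N : leftHopfModule H) (f : lhmHom M N) (g : {linear N -> M}).
Hypotheses (fK : cancel f g) (gK : cancel g f).

Fact lhm_hom_inverse_act h n : g (act (h ⊗t n)) = act (h ⊗t g n).
Proof. by rewrite -{1}[n]gK -lhm_hom_act fK. Qed.

Fact lhm_hom_inverse_proj n : g (E n) = E (g n).
Proof. by rewrite -{1}[n]gK -lhm_hom_proj fK. Qed.

Definition lhm_hom_inverse : lhmHom N M :=
  lhm_hom_of_proj lhm_hom_inverse_act lhm_hom_inverse_proj.

End HomInverse.

End LeftModules.

(** * Free left Hopf modules *)

Section FreeLeftModule.
Variables (K : fieldType) (H : hopfCoquasigroup K).

Local Notation Δ := (hcq_delta H).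
Local Notation ε := (hcq_eps H).
Local Notation S := (hcq_antipode H).
Local Notation μ := (alg_mul H).
Local Notation E := (@lhm_proj _ _ _).

Section Objects.
Variable V : lmodType K.

Definition lfree_coact : H ⊗ V -> H ⊗ (H ⊗ V) := assocr H H V \o (Δ ⊗m idm V).
HB.instance Definition _ := GRing.Linear.on lfree_coact.

Definition lfree_act : H ⊗ (H ⊗ V) -> H ⊗ V := (μ ⊗m idm V) \o assocl H H V.
HB.instance Definition _ := GRing.Linear.on lfree_act.

Lemma lfree_coactE h v : lfree_coact (h ⊗t v) = assocr H H V (Δ h ⊗t v).
Proof. by rewrite /lfree_coact; tens_simpl. Qed.

Lemma lfree_actE g h v : lfree_act (g ⊗t (h ⊗t v)) = (g * h) ⊗t v.
Proof. by rewrite /lfree_act; tens_simpl. Qed.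

Lemma tlmul_assocr h (y : H ⊗ H) v :
  tlmul h (assocr H H V (y ⊗t v)) = assocr H H V (tlmul h y ⊗t v).
Proof. by rewrite /tlmul; tens_elim y => ? ?; tens_simpl. Qed.

Lemma map_assocr (f : {linear H -> H}) (y : H ⊗ H) v :
  (f ⊗m idm (H ⊗ V)) (assocr H H V (y ⊗t v)) =
  assocr H H V ((f ⊗m idm H) y ⊗t v).
Proof. by tens_elim y => ? ?; tens_simpl. Qed.

Lemma comp_lfree_coact_sum (W : lmodType K) (F : {linear H ⊗ (H ⊗ V) -> W})
    h v s :
    Δ h = \sum_(p <- s) p.1 ⊗t p.2 ->
  (F \o lfree_coact) (h ⊗t v) = \sum_(p <- s) F (p.1 ⊗t (p.2 ⊗t v)).
Proof.
move=> Es; rewrite [LHS]/comp lfree_coactE.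
apply: (etrans (comp_tens_sum (F \o assocr H H V \o tensl v) Es)).
by apply: eq_bigr => p _; rewrite /= /tensl assocrE.
Qed.

Fact lfree_counit :
  tens_unitl (H ⊗ V) \o (ε ⊗m idm (H ⊗ V)) \o lfree_coact =1 idm (H ⊗ V).
Proof.
move=> x; tens_elim x => h v; rewrite lfree_coactE -[in RHS](counitlE h) /=.
move: (Δ h) => y.
by tens_elim y => ? ?; tens_simpl; rewrite tensZl.
Qed.

Fact lfree_act1 (x : H ⊗ V) : lfree_act (1 ⊗t x) = x.
Proof. by tens_elim x => ? ?; rewrite lfree_actE mul1r. Qed.

Fact lfree_actA g h (x : H ⊗ V) :
  lfree_act (g ⊗t lfree_act (h ⊗t x)) = lfree_act ((g * h) ⊗t x).
Proof. by tens_elim x => ? ?; rewrite !lfree_actE mulrA. Qed.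

Fact lfree_antipodeSl :
  (μ ⊗m idm (H ⊗ V)) \o assocl H H (H ⊗ V)
  \o (S ⊗m (idm H ⊗m idm (H ⊗ V)))
  \o (idm H ⊗m lfree_coact) \o lfree_coact =1 (fun x => 1 ⊗t x).
Proof.
apply: (@tens_ext _ _ _ _ (_ \o lfree_coact) (tensr 1)) => h v.
have [s Es [D _ _ _]] := delta_sum h.
rewrite -[RHS](assocrE 1 h v).
rewrite -[RHS](sum_linear_congr (assocr H H V \o tensl v) D).
apply: (etrans (comp_lfree_coact_sum _ v Es)).
apply: eq_bigr => p _; rewrite /= !tens_mapE /= tens_map_id lfree_coactE.
exact: tlmul_assocr.
Qed.

Fact lfree_antipodelS :
  (μ ⊗m idm (H ⊗ V)) \o assocl H H (H ⊗ V)
  \o (idm H ⊗m (S ⊗m idm (H ⊗ V)))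
  \o (idm H ⊗m lfree_coact) \o lfree_coact =1 (fun x => 1 ⊗t x).
Proof.
apply: (@tens_ext _ _ _ _ (_ \o lfree_coact) (tensr 1)) => h v.
have [s Es [_ D _ _]] := delta_sum h.
rewrite -[RHS](assocrE 1 h v).
rewrite -[RHS](sum_linear_congr (assocr H H V \o tensl v) D).
apply: (etrans (comp_lfree_coact_sum _ v Es)).
apply: eq_bigr => p _; rewrite /= !tens_mapE /= lfree_coactE map_assocr.
exact: tlmul_assocr.
Qed.

Fact lfree_compat :
  lfree_coact \o lfree_act =1
    (μ ⊗m lfree_act) \o mid_flip H H H (H ⊗ V) \o (Δ ⊗m lfree_coact).
Proof.
apply: tens_ext => h x; rewrite /=; tens_elim x => g v.
rewrite tens_mapE lfree_actE /= !lfree_coactE delta_mul.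
move: (Δ g) (Δ h) => y z; tens_elim y => ? ?; tens_elim z => ? ?; tens_simpl.
by rewrite lfree_actE.
Qed.

Definition lfree : leftHopfModule H :=
  LeftHopfModule lfree_counit lfree_act1 lfree_actA
    lfree_antipodeSl lfree_antipodelS lfree_compat.

Definition lfree_eps : {linear lfree -> V} := tens_unitl V \o (ε ⊗m idm V).

Lemma lfree_epsE h v : lfree_eps (h ⊗t v) = (ε h : K) *: v.
Proof. by rewrite /lfree_eps; tens_simpl. Qed.

(** On h (x) v the projection gives S(h_1) h_2 (x) v. *)
Lemma lfree_proj (x : lfree) : E x = 1 ⊗t lfree_eps x.
Proof.
rewrite /lhm_proj /=; tens_elim x => h v; rewrite lfree_coactE.
have P (y : H ⊗ H) :
    lfree_act ((S ⊗m idm (H ⊗ V)) (assocr H H V (y ⊗t v))) =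
    μ ((S ⊗m idm H) y) ⊗t v.
  by tens_elim y => ? ?; tens_simpl; rewrite lfree_actE.
by rewrite P mul_antipodel tens_mapE tens_unitlE tensZl tensZr.
Qed.

End Objects.

Section Morphisms.
Variables (V W : lmodType K).

Section Map.
Variable g : {linear V -> W}.

Fact lfree_map_act h (x : lfree V) :
  (idm H ⊗m g) (lhm_act _ (h ⊗t x)) =
  lhm_act (lfree W) (h ⊗t (idm H ⊗m g) x).
Proof.
by rewrite /=; tens_elim x => ? ?; rewrite lfree_actE !tens_mapE lfree_actE.
Qed.

Fact lfree_map_proj (x : lfree V) :
  (idm H ⊗m g) (E x) = E ((idm H ⊗m g) x : lfree W).
Proof.
rewrite !lfree_proj tens_mapE; congr (_ ⊗t _).
by tens_elim x => ? ?; tens_simpl; rewrite linearZ.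
Qed.

Definition lfree_map : lhmHom (lfree V) (lfree W) :=
  @lhm_hom_of_proj K H (lfree V) (lfree W) (idm H ⊗m g) lfree_map_act
    lfree_map_proj.

End Map.

Definition lfree_preim (f : lhmHom (lfree V) (lfree W)) : {linear V -> W} :=
  lfree_eps W \o f \o tensr 1.

Lemma lfree_mapK : cancel lfree_map lfree_preim.
Proof.
move=> g; apply: linear_map_ext => v.
by rewrite /lfree_preim /= /tensr; tens_simpl; rewrite hcq_eps1 scale1r.
Qed.

Lemma lfree_preimK : cancel lfree_preim lfree_map.
Proof.
move=> f; apply: lhmHom_ext => x /=; tens_elim x => h v.
have -> : h ⊗t v = lhm_act (lfree V) (h ⊗t (1 ⊗t v)).
  by rewrite /= lfree_actE mulr1.
(* Since [f] commutes with [E], it maps the fixed vector 1 (x) v to some 1 (x) w. *)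
have {2}-> : 1 ⊗t v = E (1 ⊗t v : lfree V).
  by rewrite lfree_proj lfree_epsE hcq_eps1 scale1r.
rewrite lhm_hom_act lhm_hom_proj lfree_proj /= !lfree_actE tens_mapE.
by rewrite !mulr1.
Qed.

End Morphisms.

Fact lfree_functor1 (V : lmodType K) : lfree_map (idm V) = lhm_id (lfree V).
Proof. by apply: lhmHom_ext => x /=; rewrite tens_map_id. Qed.

Fact lfree_functorM (U V W : lmodType K) (g : {linear V -> W})
    (f : {linear U -> V}) :
  lfree_map (linear_comp g f) = lhm_comp (lfree_map g) (lfree_map f).
Proof. by apply: lhmHom_ext => x /=; rewrite tens_map_compr. Qed.

Definition lfree_functor : functor (Vect K) (LeftHopfMod H) :=
  @Functor (Vect K) (LeftHopfMod H) lfree lfree_map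
    lfree_functor1 lfree_functorM.

(** * Reconstruction of a left Hopf module from its coinvariants *)

Section Coinvariants.
Variable M : leftHopfModule H.

Definition lhm_coinv := fixed (@lhm_proj K H M).

Definition lhm_coinv_gen : {linear lfree lhm_coinv -> M} :=
  lhm_act M \o (idm H ⊗m @fixed_val _ _ (@lhm_proj K H M)).

Lemma lhm_coinv_genE h n :
  lhm_coinv_gen (h ⊗t n) = lhm_act M (h ⊗t fixed_val n).
Proof. by rewrite /lhm_coinv_gen; tens_simpl. Qed.

Fact lhm_coinv_gen_act h (x : lfree lhm_coinv) :
  lhm_coinv_gen (lhm_act _ (h ⊗t x)) = lhm_act M (h ⊗t lhm_coinv_gen x).
Proof.
tens_elim x => g n.
by rewrite lfree_actE; tens_simpl; rewrite lhm_actA.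
Qed.

Fact lhm_coinv_gen_proj (x : lfree lhm_coinv) :
  lhm_coinv_gen (E x) = E (lhm_coinv_gen x).
Proof.
rewrite lfree_proj lhm_coinv_genE lhm_act1; tens_elim x => h n; tens_simpl.
by rewrite lhm_proj_act [in RHS]fixed_valP.
Qed.

Definition lhm_coinv_hom : lhmHom (lfree lhm_coinv) M :=
  lhm_hom_of_proj lhm_coinv_gen_act lhm_coinv_gen_proj.

Definition lhm_coinv_inv : {linear M -> lfree lhm_coinv} :=
  (idm H ⊗m fixed_proj (@lhm_projK K H M)) \o lhm_coact M.

Lemma lhm_coinv_invK : cancel lhm_coinv_inv lhm_coinv_hom.
Proof.
move=> m; rewrite -[RHS]lhm_splitK /lhm_split /=; congr (lhm_act _ _).
by move: (lhm_coact M m) => x; tens_elim x => ? ?; tens_simpl.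
Qed.

Lemma lhm_coinv_homK : cancel lhm_coinv_hom lhm_coinv_inv.
Proof.
pose p := fixed_proj (@lhm_projK K H M).
have pE (x : H ⊗ M) :
    (idm H ⊗m p) x = (idm H ⊗m p) ((idm H ⊗m @lhm_proj K H M) x).
  tens_elim x => h m; tens_simpl; congr (_ ⊗t _).
  by apply: val_inj; rewrite /= lhm_projK.
move=> x; rewrite /= pE; tens_elim x => h n.
(* Since n = E n, the split of h . n is h . (1 (x) n). *)
have e :
    (idm H ⊗m @lhm_proj K H M) (lhm_coact M (lhm_act M (h ⊗t fixed_val n))) =
    h ⊗t fixed_val n.
  rewrite [LHS]lhm_split_act -fixed_valP lhm_split_proj tlmulE.
  by rewrite mulr1.
by rewrite tens_mapE e tens_mapE; congr (_ ⊗t _); exact: fixed_valK.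
Qed.

End Coinvariants.

Lemma left_hopf_modules_equivalent_vect :
  cat_equivalent (LeftHopfMod H) (Vect K).
Proof.
apply: (@equivalence_of_fully_faithful _ _ lfree_functor lfree_preim lfree_mapK
  lfree_preimK lhm_coinv
  (fun M => lhm_hom_inverse (@lhm_coinv_homK M) (@lhm_coinv_invK M))
  lhm_coinv_hom).
- by move=> M; apply: lhmHom_ext => x; exact: lhm_coinv_homK.
- by move=> M; apply: lhmHom_ext => x; exact: lhm_coinv_invK.
Qed.

End FreeLeftModule.

Theorem theorem3p13 (K : fieldType) (H : hopfCoquasigroup K) :
  cat_equivalent (RightHopfMod H) (Vect K) /\
  cat_equivalent (LeftHopfMod H) (Vect K).
Proof.
split; first exact: right_hopf_modules_equivalent_vect.
exact: left_hopf_modules_equivalent_vect.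
Qed.
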